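(* Let $V$ be a countable-dimensional (infinite-dimensional) complex vector space. a) $\mathfrak{gl}(V,V_* )\oplus\mathbb{C}\,\mathrm{Id}$ is an ideal in $\mathfrak{gl}^M(V,V_* )$ and the quotient $\mathfrak{gl}^M(V,V_* )/\left(\mathfrak{gl}(V,V_* )\oplus\mathbb{C}\,\mathrm{Id}\right)$ is a simple Lie algebra. b) $\mathfrak{gl}(V,V^* )\oplus\mathbb{C}\,\mathrm{Id}$ is an ideal in $\mathrm{End}(V)$ and the quotient $\mathrm{End}(V)/\left(\mathfrak{gl}(V,V^* )\oplus\mathbb{C}\,\mathrm{Id}\right)$ is a simple Lie algebra. c) If $V$ is equipped with a non-degenerate symmetric (respectively, antisymmetric) bilinear form, then $\mathfrak{o}^M(V)/\mathfrak{o}(V)$ (respectively, $\mathfrak{sp}^M(V)/\mathfrak{sp}(V)$) is a simple Lie algebra.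
   Context: The ground field is $\mathbb{C}$. $V^*$ is the full dual space of $V$. For countable-dimensional $V$, $V_*$ is a countable-dimensional space with a non-degenerate pairing $V\times V_*\to\mathbb{C}$ (unique up to isomorphism); concretely there is a basis $\{v_1,v_2,\dots\}$ of $V$ such that $V_*=\mathrm{span}\{v_1^*,v_2^*,\dots\}\subset V^*$, where $v_i^*(v_j)=\delta_{ij}$. For a non-degenerate pairing $V\times W\to\mathbb{C}$, regard $W\subset V^*$. The Mackey Lie algebra $\mathfrak{gl}^M(V,W)$ is the Lie algebra (under commutator) of all $\phi\in\mathrm{End}(V)$ whose dual $\phi^*:V^*\to V^*$ satisfies $\phi^*(W)\subset W$. In particular $\mathfrak{gl}^M(V,V^* )=\mathrm{End}(V)$. $\mathfrak{gl}(V,W)=V\otimes W$ is identified with the Lie subalgebra of $\mathfrak{gl}^M(V,W)$ spanned by the finite rank operators $v\otimes w: x\mapsto w(x)v$. If $V$ carries a non-degenerate symmetric (respectively, antisymmetric) form $(\cdot,\cdot)$, then $\mathfrak{o}^M(V)$ (respectively, $\mathfrak{sp}^M(V)$) is the Lie algebra of all $X\in\mathrm{End}(V)$ with $(Xv,w)+(v,Xw)=0$ for all $v,w\in V$, and $\mathfrak{o}(V)$ (respectively, $\mathfrak{sp}(V)$) is its ideal consisting of operators of finite rank. *)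

(* Defs.v *)
From HB Require Import structures.
From mathcomp Require Import all_boot all_algebra.
From mathcomp Require Import boolp classical_sets.
From mathcomp Require Import reals complex.

Set Implicit Arguments.
Unset Strict Implicit.
Unset Printing Implicit Defensive.

Import GRing.Theory.
Import Quotient.

Local Open Scope ring_scope.
Local Open Scope classical_set_scope.
Local Open Scope quotient_scope.

Reserved Notation "[ 'lie' x , y ]"
  (at level 0, format "[ 'lie'  x ,  y ]").

Section LinearAlgebra.
Variable K : comNzRingType.

Definition lin_span (L : lmodType K) (A : set L) : set L :=
  [set x | exists n (a : 'I_n -> L) (c : 'I_n -> K),
     (forall i, A (a i)) /\ x = \sum_(i < n) c i *: a i].

Definition is_subspace (L : lmodType K) (A : set L) : Prop :=
  A 0 /\ forall (a : K) x y, A x -> A y -> A (a *: x + y).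

Definition is_basis (V : lmodType K) (e : nat -> V) : Prop :=
  (forall n (c : 'I_n -> K), \sum_(i < n) c i *: e i = 0 -> forall i, c i = 0)
  /\ lin_span (range e) = setT.

(* countably infinite dimension *)
Definition countable_dim (V : lmodType K) : Prop :=
  exists e : nat -> V, is_basis e.

(* S is the internal direct sum of the linear subspaces A and B *)
Definition direct_sum (L : lmodType K) (A B S : set L) : Prop :=
  S = [set a + b | a in A & b in B] /\ A `&` B = [set 0].

Definition finite_rank (U V : lmodType K) (f : {linear U -> V}) : Prop :=
  exists n (a : 'I_n -> V), range f `<=` lin_span (range a).

Definition nondegenerate_form (V W : lmodType K) (p : V -> W -> K) : Prop :=
  (forall v, (forall w, p v w = 0) -> v = 0) /\
  (forall w, (forall v, p v w = 0) -> w = 0).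

End LinearAlgebra.

Section LinearMaps.
Variables (K : comNzRingType) (U V : lmodType K).
Implicit Types f g h : {linear U -> V}.

HB.instance Definition _ := gen_eqMixin {linear U -> V}.
HB.instance Definition _ := gen_choiceMixin {linear U -> V}.

Lemma linP f g : f =1 g -> f = g.
Proof.
case: f => f [[f1] [f2]]; case: g => g [[g1] [g2]] /= /funext e.
subst g.
by rewrite (Prop_irrelevance f1 g1) (Prop_irrelevance f2 g2).
Qed.

Definition lin_zero : {linear U -> V} := \0.
Definition lin_opp f : {linear U -> V} := \- f.
Definition lin_add f g : {linear U -> V} := f \+ g.
Definition lin_scale a f : {linear U -> V} := a \*: f.

Lemma lin_addA : associative lin_add.
Proof. by move=> f g h; apply: linP => x /=; rewrite addrA. Qed.
Lemma lin_addC : commutative lin_add.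
Proof. by move=> f g; apply: linP => x /=; rewrite addrC. Qed.
Lemma lin_add0 : left_id lin_zero lin_add.
Proof. by move=> f; apply: linP => x /=; rewrite add0r. Qed.
Lemma lin_addN : left_inverse lin_zero lin_opp lin_add.
Proof. by move=> f; apply: linP => x /=; rewrite addNr. Qed.

HB.instance Definition _ :=
  GRing.isZmodule.Build {linear U -> V} lin_addA lin_addC lin_add0 lin_addN.

Lemma lin_scaleA a b f : lin_scale a (lin_scale b f) = lin_scale (a * b) f.
Proof. by apply: linP => x /=; rewrite scalerA. Qed.
Lemma lin_scale1 : left_id 1 lin_scale.
Proof. by move=> f; apply: linP => x /=; rewrite scale1r. Qed.
Lemma lin_scaleDr : right_distributive lin_scale +%R.
Proof. by move=> a f g; apply: linP => x /=; rewrite scalerDr. Qed.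
Lemma lin_scaleDl f : {morph lin_scale^~ f : a b / a + b}.
Proof. by move=> a b; apply: linP => x /=; rewrite scalerDl. Qed.

HB.instance Definition _ := GRing.Zmodule_isLmodule.Build K {linear U -> V}
  lin_scaleA lin_scale1 lin_scaleDr lin_scaleDl.

Lemma lin0E x : (0 : {linear U -> V}) x = 0. Proof. by []. Qed.
Lemma linNE f x : (- f) x = - f x. Proof. by []. Qed.
Lemma linDE f g x : (f + g) x = f x + g x. Proof. by []. Qed.
Lemma linZE a f x : (a *: f) x = a *: f x. Proof. by []. Qed.

End LinearMaps.

HB.mixin Record Lmodule_isLieAlgebra (K : comNzRingType) (L : Type)
    of GRing.Lmodule K L := {
  bracket : L -> L -> L;
  bracketPl : forall z : L, linear (bracket^~ z);
  bracketPr : forall z : L, linear (bracket z);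
  bracketxx : forall x : L, bracket x x = 0;
  jacobi : forall x y z : L,
    bracket x (bracket y z) + bracket y (bracket z x) + bracket z (bracket x y)
      = 0
}.

#[short(type="lieAlgType")]
HB.structure Definition LieAlgebra (K : comNzRingType) :=
  {L of GRing.Lmodule K L & Lmodule_isLieAlgebra K L}.

Notation "[ 'lie' x , y ]" := (bracket x y) : ring_scope.

Record lieSubalgebra (K : comNzRingType) (L : lieAlgType K) := LieSubalgebra {
  subalgebra_set :> set L;
  subalgebra_subspace : is_subspace subalgebra_set;
  subalgebra_bracket : forall x y,
    subalgebra_set x -> subalgebra_set y -> subalgebra_set [lie x, y]
}.

Record lieIdeal (K : comNzRingType) (L : lieAlgType K) := LieIdeal {
  ideal_set :> set L;
  ideal_subspace : is_subspace ideal_set;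
  ideal_bracket : forall x y, ideal_set y -> ideal_set [lie x, y]
}.

Definition simple_lie (K : comNzRingType) (L : lieAlgType K) : Prop :=
  (exists x y : L, [lie x, y] <> 0) /\
  (forall I : lieIdeal L, I = [set 0] :> set L \/ I = setT :> set L).

Section LieTheory.
Variables (K : comNzRingType) (L : lieAlgType K).
Implicit Types x y z : L.

Lemma bracketDl z : {morph bracket^~ z : x y / x + y}.
Proof. by move=> x y; have := bracketPl z 1 x y; rewrite !scale1r. Qed.
Lemma bracketDr z : {morph bracket z : x y / x + y}.
Proof. by move=> x y; have := bracketPr z 1 x y; rewrite !scale1r. Qed.
Lemma bracketNl z : {morph bracket^~ z : x / - x}.
Proof.
move=> x; apply/eqP; rewrite -addr_eq0 -bracketDl addNr; apply/eqP.
by apply: (addrI [lie 0, z]); rewrite -bracketDl !addr0.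
Qed.
Lemma bracketC x y : [lie x, y] = - [lie y, x].
Proof.
apply/eqP; rewrite -addr_eq0; apply/eqP.
by have := bracketxx (x + y);
  rewrite bracketDl !bracketDr !bracketxx add0r addr0.
Qed.
Lemma bracketNr z : {morph bracket z : x / - x}.
Proof. by move=> x; rewrite bracketC bracketNl opprK bracketC. Qed.
Lemma bracketBl z : {morph bracket^~ z : x y / x - y}.
Proof. by move=> x y; rewrite bracketDl bracketNl. Qed.
Lemma bracketBr z : {morph bracket z : x y / x - y}.
Proof. by move=> x y; rewrite bracketDr bracketNr. Qed.

End LieTheory.

Section SubLie.
Variables (K : comNzRingType) (L : lieAlgType K) (S : lieSubalgebra L).

Definition subalgebra_pred : {pred L} := fun x => x \in (S : set L).

Lemma subalgebra_pred_closed : submod_closed subalgebra_pred.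
Proof.
have [S0 SP] := subalgebra_subspace S.
split=> [|a x y]; first exact/mem_set.
by move=> /set_mem Sx /set_mem Sy; apply/mem_set/SP.
Qed.

HB.instance Definition _ :=
  GRing.isSubmodClosed.Build K L subalgebra_pred subalgebra_pred_closed.

Definition sub_lie := {x : L | x \in subalgebra_pred}.

HB.instance Definition _ := SubChoice.on sub_lie.
HB.instance Definition _ := [SubChoice_isSubLmodule of sub_lie by <:].

Lemma sub_bracket_subproof (x y : sub_lie) : [lie val x, val y] \in subalgebra_pred.
Proof. by apply/mem_set/subalgebra_bracket; apply/set_mem; exact: valP. Qed.

Definition sub_bracket (x y : sub_lie) : sub_lie :=
  Sub [lie val x, val y] (sub_bracket_subproof x y).

Lemma sub_bracketPl z : linear (sub_bracket^~ z).
Proof.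
by move=> a x y; apply: val_inj; rewrite !(linearP, SubK) /= bracketPl.
Qed.
Lemma sub_bracketPr z : linear (sub_bracket z).
Proof.
by move=> a x y; apply: val_inj; rewrite !(linearP, SubK) /= bracketPr.
Qed.
Lemma sub_bracketxx x : sub_bracket x x = 0.
Proof. by apply: val_inj; rewrite SubK bracketxx raddf0. Qed.
Lemma sub_jacobi x y z :
  sub_bracket x (sub_bracket y z) + sub_bracket y (sub_bracket z x)
    + sub_bracket z (sub_bracket x y) = 0.
Proof. by apply: val_inj; rewrite !(raddfD, SubK) jacobi. Qed.

HB.instance Definition _ := Lmodule_isLieAlgebra.Build K sub_lie
  sub_bracketPl sub_bracketPr sub_bracketxx sub_jacobi.

Lemma val_lie0 : val (0 : sub_lie) = 0.
Proof. exact: (@linear0 _ _ _ _ (\val : {linear sub_lie -> L})). Qed.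
Lemma val_lieP a (x y : sub_lie) : val (a *: x + y) = a *: val x + val y.
Proof. exact: (@linearP _ _ _ _ (\val : {linear sub_lie -> L})). Qed.
Lemma val_bracket (x y : sub_lie) : val [lie x, y] = [lie val x, val y].
Proof. by []. Qed.

End SubLie.

Section LieQuotient.
Variables (K : comNzRingType) (L : lieAlgType K) (I : lieIdeal L).

Definition ideal_pred : {pred L} := fun x => x \in (I : set L).

Lemma ideal_pred_closed : submod_closed ideal_pred.
Proof.
have [I0 IP] := ideal_subspace I.
split=> [|a x y]; first exact/mem_set.
by move=> /set_mem Ix /set_mem Iy; apply/mem_set/IP.
Qed.

HB.instance Definition _ :=
  GRing.isSubmodClosed.Build K L ideal_pred ideal_pred_closed.

Lemma ideal_pred_bracket x y : y \in ideal_pred -> [lie x, y] \in ideal_pred.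
Proof. by move=> /set_mem Iy; apply/mem_set/ideal_bracket. Qed.

(* the quotient Z-module of ring_quotient, made into a Lie algebra below *)
Definition lie_quot := {quot ideal_pred}.
HB.instance Definition _ := GRing.Zmodule.on lie_quot.
Local Notation Q := lie_quot.

Lemma pi_eq (x y : L) : x - y \in ideal_pred -> \pi_Q x = \pi_Q y.
Proof. by rewrite idealrBE => /eqP. Qed.

Lemma pi_eqP (x y : L) : \pi_Q x = \pi_Q y -> x - y \in ideal_pred.
Proof. by rewrite idealrBE => ->. Qed.

Definition quot_scale (a : K) (u : Q) : Q := \pi_Q (a *: repr u).
Definition quot_bracket (u v : Q) : Q := \pi_Q [lie repr u, repr v].

Lemma pi_addE (x y : L) : \pi_Q (x + y) = \pi_Q x + \pi_Q y.
Proof. exact: (raddfD \pi_{quot ideal_pred}). Qed.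

Lemma pi_zeroE : \pi_Q (0 : L) = 0.
Proof. exact: (raddf0 \pi_{quot ideal_pred}). Qed.

Lemma pi_scale a x : \pi_Q (a *: x) = quot_scale a (\pi_Q x).
Proof.
apply: pi_eq; rewrite -scalerBr; apply: rpredZ; apply: pi_eqP.
by rewrite reprK.
Qed.

Lemma pi_bracket x y : \pi_Q [lie x, y] = quot_bracket (\pi_Q x) (\pi_Q y).
Proof.
set x' := repr (\pi_Q x); set y' := repr (\pi_Q y).
have Ix : x - x' \in ideal_pred by apply: pi_eqP; rewrite reprK.
have Iy : y - y' \in ideal_pred by apply: pi_eqP; rewrite reprK.
apply: pi_eq.
have -> : [lie x, y] - [lie x', y'] = [lie x, y - y'] + [lie x - x', y'].
  by rewrite bracketBr bracketBl addrA subrK.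
apply: rpredD; first exact: ideal_pred_bracket.
by rewrite bracketC rpredN; exact: ideal_pred_bracket.
Qed.

Lemma pi_surj (u : Q) : exists x : L, u = \pi_Q x.
Proof. by exists (repr u); rewrite reprK. Qed.

Lemma quot_scaleA a b u :
  quot_scale a (quot_scale b u) = quot_scale (a * b) u.
Proof.
have [x ->] := pi_surj u.
by rewrite -(pi_scale b x) -(pi_scale a) -(pi_scale _ x) scalerA.
Qed.
Lemma quot_scale1 : left_id 1 quot_scale.
Proof. by move=> u; have [x ->] := pi_surj u; rewrite -(pi_scale 1 x) scale1r. Qed.
Lemma quot_scaleDr : right_distributive quot_scale +%R.
Proof.
move=> a u v; have [x ->] := pi_surj u; have [y ->] := pi_surj v.
by rewrite -(pi_addE x y) -!(pi_scale a) -pi_addE scalerDr.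
Qed.
Lemma quot_scaleDl u : {morph quot_scale^~ u : a b / a + b}.
Proof.
move=> a b; have [x ->] := pi_surj u.
by rewrite -!(pi_scale _ x) -pi_addE scalerDl.
Qed.

HB.instance Definition _ := GRing.Zmodule_isLmodule.Build K Q
  quot_scaleA quot_scale1 quot_scaleDr quot_scaleDl.

Lemma pi_scaleE a x : \pi_Q (a *: x) = a *: (\pi_Q x : Q) :> Q.
Proof. exact: pi_scale. Qed.

Lemma quot_bracketPl z : linear (quot_bracket^~ z).
Proof.
move=> a u v; have [x ->] := pi_surj u; have [y ->] := pi_surj v.
have [w ->] := pi_surj z.
by rewrite -(pi_scaleE a x) -pi_addE -!(pi_bracket _ w) bracketPl
  pi_addE pi_scaleE.
Qed.
Lemma quot_bracketPr z : linear (quot_bracket z).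
Proof.
move=> a u v; have [x ->] := pi_surj u; have [y ->] := pi_surj v.
have [w ->] := pi_surj z.
by rewrite -(pi_scaleE a x) -pi_addE -!(pi_bracket w) bracketPr
  pi_addE pi_scaleE.
Qed.
Lemma quot_bracketxx u : quot_bracket u u = 0.
Proof.
by have [x ->] := pi_surj u; rewrite -(pi_bracket x x) bracketxx pi_zeroE.
Qed.
Lemma quot_jacobi u v w :
  quot_bracket u (quot_bracket v w) + quot_bracket v (quot_bracket w u)
    + quot_bracket w (quot_bracket u v) = 0.
Proof.
have [x ->] := pi_surj u; have [y ->] := pi_surj v; have [z ->] := pi_surj w.
rewrite -(pi_bracket y z) -(pi_bracket z x) -(pi_bracket x y).
rewrite -(pi_bracket x) -(pi_bracket y) -(pi_bracket z) -!pi_addE.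
by rewrite jacobi pi_zeroE.
Qed.

HB.instance Definition _ := Lmodule_isLieAlgebra.Build K Q
  quot_bracketPl quot_bracketPr quot_bracketxx quot_jacobi.

Lemma pi_bracketE x y : \pi_Q [lie x, y] = [lie (\pi_Q x : Q), (\pi_Q y : Q)] :> Q.
Proof. exact: pi_bracket. Qed.

End LieQuotient.

(* End(V) is {linear V -> V} under the commutator. *)
Section EndLie.
Variables (K : comNzRingType) (V : lmodType K).
Implicit Types f g h : {linear V -> V}.

Definition commutator f g : {linear V -> V} := (f \o g) \- (g \o f).

Lemma commutatorPl h : linear (commutator^~ h).
Proof.
move=> a f g; apply: linP => x /=; rewrite linearP.
by rewrite opprD scalerBr addrACA.
Qed.
Lemma commutatorPr h : linear (commutator h).
Proof.
move=> a f g; apply: linP => x /=; rewrite linearP.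
by rewrite opprD scalerBr addrACA.
Qed.
Lemma commutatorxx f : commutator f f = 0.
Proof. by apply: linP => x /=; rewrite subrr. Qed.
Lemma commutator_jacobi f g h :
  commutator f (commutator g h) + commutator g (commutator h f)
    + commutator h (commutator f g) = 0.
Proof.
apply: linP => x /=; rewrite !linearB /=.
set a := f (g (h x)); set b := f (h (g x)); set c := g (h (f x)).
set d := g (f (h x)); set e := h (f (g x)); set i := h (g (f x)).
rewrite !opprK (AC ((2*2)*(2*2)*(2*2))
  ((1*11)*(8*2)*(5*3)*(12*6)*(9*7)*(4*10))) /=.
by rewrite !subrr !addr0.
Qed.

HB.instance Definition _ := Lmodule_isLieAlgebra.Build K {linear V -> V}
  commutatorPl commutatorPr commutatorxx commutator_jacobi.

Definition scalar_ops : set {linear V -> V} :=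
  [set a *: (idfun : {linear V -> V}) | a in setT].

End EndLie.

Arguments scalar_ops {K} V.

Section Pairings.
Variables (K : comNzRingType) (V : lmodType K).

Definition dual_map (f : {linear V -> V}) (u : {linear V -> K^o}) :
  {linear V -> K^o} := u \o f.

Definition eval_pairing (v : V) (u : {linear V -> K^o}) : K^o := u v.

Lemma eval_pairing_is_bilinear : bilinear_for
  (GRing.Scale.Law.clone _ _ *:%R _) (GRing.Scale.Law.clone _ _ *:%R _)
  eval_pairing.
Proof. by split=> [u|v] a x y //=; exact: linearP. Qed.

HB.instance Definition _ := bilinear_isBilinear.Build K V {linear V -> K^o}
  K^o _ _ eval_pairing eval_pairing_is_bilinear.

Variables (W : lmodType K) (p : {bilinear V -> W -> K^o}).

(* W regarded as a subspace of V^* *)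
Definition dual_of (w : W) : {linear V -> K^o} := applyr p w.

Definition tensor_op (v : V) (w : W) (x : V) : V := p x w *: v.

Lemma tensor_op_is_linear v w : linear (tensor_op v w).
Proof.
by move=> a x y; rewrite /tensor_op linearPl scalerDl scalerA.
Qed.

HB.instance Definition _ v w :=
  GRing.isLinear.Build K V V *:%R (tensor_op v w) (tensor_op_is_linear v w).

Definition gl : set {linear V -> V} :=
  lin_span [set (tensor_op v w : {linear V -> V}) | v in setT & w in setT].

Definition glM_set : set {linear V -> V} :=
  [set f | dual_map f @` range dual_of `<=` range dual_of].

Lemma glMP f : glM_set f <-> forall w, exists w', forall x, p (f x) w = p x w'.
Proof.
split=> [fW w|fW].
  have [|w' _ e] := fW (dual_map f (dual_of w)).
    by exists (dual_of w) => //; exists w.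
  exists w' => x.
  by have := congr1 (fun u : {linear V -> K^o} => u x) e.
move=> _ [_ [w _ <-] <-]; have [w' e] := fW w.
by exists w' => //; apply: linP => x /=; rewrite -[RHS]/(p (f x) w) e.
Qed.

Lemma glM_subspace : is_subspace glM_set.
Proof.
split=> [|a f g /glMP fW /glMP gW].
  by apply/glMP => w; exists 0 => x; rewrite lin0E linear0l linear0r.
apply/glMP => w; have [w1 e1] := fW w; have [w2 e2] := gW w.
exists (a *: w1 + w2) => x.
by rewrite linDE linZE linearPl linearPr e1 e2.
Qed.

Lemma glM_bracket f g : glM_set f -> glM_set g -> glM_set [lie f, g].
Proof.
move=> /glMP fW /glMP gW; apply/glMP => w.
have [w1 e1] := fW w; have [w2 e2] := gW w.
have [w3 e3] := gW w1; have [w4 e4] := fW w2.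
exists (w3 - w4) => x.
by rewrite -[[lie f, g] x]/(f (g x) - g (f x)) linearBl linearBr e1 e2 e3 e4.
Qed.

Definition glM : lieSubalgebra {linear V -> V} :=
  LieSubalgebra glM_subspace glM_bracket.

End Pairings.

Section FiniteRank.
Variables (K : comNzRingType) (V : lmodType K).
Implicit Types f g : {linear V -> V}.

Lemma finite_rank_in f n (a : 'I_n -> V) (c : V -> 'I_n -> K) :
  (forall x, f x = \sum_(i < n) c x i *: a i) -> finite_rank f.
Proof.
move=> e; exists n, a => _ [x _ <-]; exists n, a, (c x).
by split=> // i; exists i.
Qed.

Lemma finite_rank_out f : finite_rank f ->
  exists n (a : 'I_n -> V) (c : V -> 'I_n -> K),
    forall x, f x = \sum_(i < n) c x i *: a i.
Proof.
move=> [n [a fa]]; exists n, a.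
suff: forall x, exists c : 'I_n -> K, f x = \sum_(i < n) c i *: a i.
  by move=> /choice[c cP]; exists c.
move=> x; have [m [b [c [ba ->]]]] : lin_span (range a) (f x) by apply: fa; exists x.
have /choice[s sP] : forall j, exists i, a i = b j.
  by move=> j; have [i _ <-] := ba j; exists i.
exists (fun i => \sum_(j < m | s j == i) c j).
rewrite (partition_big s predT) //=; apply: eq_bigr => i _.
by rewrite scaler_suml; apply: eq_bigr => j /eqP <-; rewrite sP.
Qed.

Lemma finite_rank0 : finite_rank (0 : {linear V -> V}).
Proof.
apply: (@finite_rank_in _ 0 (fun=> 0) (fun _ _ => 0)) => x.
by rewrite big_ord0.
Qed.

Lemma finite_rankP a f g :
  finite_rank f -> finite_rank g -> finite_rank (a *: f + g).
Proof.
move=> /finite_rank_out[n [u [c fE]]] /finite_rank_out[m [v [d gE]]].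
pose w i := match split i with inl j => u j | inr j => v j end.
pose e x i := match @split n m i with
  | inl j => a * c x j | inr j => d x j end.
apply: (@finite_rank_in _ (n + m) w e) => x.
rewrite linDE linZE fE gE big_split_ord scaler_sumr /w /e; congr (_ + _).
  by apply: eq_bigr => i _; rewrite (unsplitK (inl i)) scalerA.
by apply: eq_bigr => i _; rewrite (unsplitK (inr i)).
Qed.

Lemma finite_rank_bracket f g : finite_rank g -> finite_rank [lie f, g].
Proof.
move=> gF; have [n [u [c gE]]] := finite_rank_out gF.
have -> : [lie f, g] = 1 *: (f \o g : {linear V -> V}) + (-1) *: (g \o f : {linear V -> V}).
  by apply: linP => x; rewrite linDE !linZE scale1r scaleN1r.
apply: finite_rankP.
  apply: (@finite_rank_in _ n (f \o u) c) => x /=.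
  by rewrite gE linear_sum; apply: eq_bigr => i _; rewrite linearZ.
rewrite -[_ *: _]addr0; apply: finite_rankP finite_rank0.
by apply: (@finite_rank_in _ n u (c \o f)) => x /=; rewrite gE.
Qed.

End FiniteRank.

(* For B symmetric, skewM B is o^M(V) and skew_fin B is o(V);
   for B skew-symmetric they are sp^M(V) and sp(V). *)
Section FormAlgebras.
Variables (K : comNzRingType) (V : lmodType K) (eps : bool).
Variable B : {hermitian V for eps & idfun}.

Definition skewM_set : set {linear V -> V} :=
  [set f | forall v w, B (f v) w + B v (f w) = 0].

Lemma skewM_subspace : is_subspace skewM_set.
Proof.
split=> [|a f g fB gB] v w.
  by rewrite !lin0E linear0l linear0r addr0.
rewrite !linDE !linZE linearPl linearPr /= addrACA -mulrDr.
by rewrite fB gB mulr0 addr0.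
Qed.

Lemma skewM_bracket f g : skewM_set f -> skewM_set g -> skewM_set [lie f, g].
Proof.
move=> fB gB v w.
have ef x y : B (f x) y = - B x (f y) by apply/eqP; rewrite -addr_eq0 fB.
have eg x y : B (g x) y = - B x (g y) by apply/eqP; rewrite -addr_eq0 gB.
rewrite -[[lie f, g] v]/(f (g v) - g (f v)).
rewrite -[[lie f, g] w]/(f (g w) - g (f w)).
by rewrite linearBl linearBr /= !ef !eg !ef !opprK addrA subrK subrr.
Qed.

Definition skewM : lieSubalgebra {linear V -> V} :=
  LieSubalgebra skewM_subspace skewM_bracket.

Definition skew_fin_set : set (sub_lie skewM) :=
  [set f | finite_rank (val f)].

Lemma skew_fin_subspace : is_subspace skew_fin_set.
Proof.
split=> [|a f g fF gF]; rewrite /skew_fin_set /mkset.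
  by rewrite val_lie0; exact: finite_rank0.
by rewrite val_lieP; exact: finite_rankP.
Qed.

Lemma skew_fin_bracket f g : skew_fin_set g -> skew_fin_set [lie f, g].
Proof. exact: finite_rank_bracket. Qed.

Definition skew_fin : lieIdeal (sub_lie skewM) :=
  LieIdeal skew_fin_subspace skew_fin_bracket.

End FormAlgebras.

(* Main.v *)
Require Import Defs.
From HB Require Import structures.
From mathcomp Require Import all_boot all_algebra.
From mathcomp Require Import boolp classical_sets.
From mathcomp Require Import reals complex.
From mathcomp Require Import ring.

Set Implicit Arguments.
Unset Strict Implicit.
Unset Printing Implicit Defensive.

Import GRing.Theory.

Local Open Scope ring_scope.
Local Open Scope classical_set_scope.

(** In suitable bases everything becomes a question about infinite matrices.
    With biorthogonal bases of V and of its countable-dimensional dual W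
    ([biorthogonal_bases]) the algebra gl^M(V,W) is the algebra of matrices
    with finite rows and columns ([glM_transposable]), and End(V) is the
    algebra of matrices with finite columns.

    Parts a) and b) are two cases of [lie_ideal_full]: let A be one of these
    algebras and U a Lie ideal of A that contains an operator u which is not
    the sum of a finite rank operator and a scalar; then U = A.  Two facts
    carry the proof.  First, such a u admits h and k in A with k u h = 1 and
    k h = 0 ([compression_to_identity]): otherwise, on a subspace of finite
    codimension and modulo a finite-dimensional subspace, u would map every
    vector to a multiple of itself.  Secondly, every a in A is a sum of two
    commutators ([sum_of_commutators]), by an infinite swindle: V is the sum of
    countably many copies of itself, and the operator acting as a on each copy
    differs from its shift exactly by one copy of a.  Given h and k, the double
    commutator of u with h k / 2 and h z k is - h z k, so that U contains h A k,
    and a few more brackets together with the swindle give all of A.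

    For part c), a non-degenerate form on V that is symmetric or antisymmetric
    has a hyperbolic basis ([hyperbolic_basis]); this splits V into two isotropic
    halves in duality and writes a skew operator as a 2 x 2 block matrix, with
    diagonal blocks a and - a^T, and with off-diagonal blocks that are
    antisymmetric (for o) or symmetric (for sp) ([skewM_blocks]).  The operator
    D = diag(1, -1) has eigenvalues 2, 0, -2 under the adjoint action, so an
    ideal U contains the three parts of each of its elements ([ideal_blocks]).
    The diagonal operators in U form a Lie ideal of the algebra of
    row-and-column-finite matrices, to which [lie_ideal_full] applies: once it
    contains an operator that is not finite rank plus scalar, it is everything,
    U contains D, and bracketing with D yields the off-diagonal parts
    ([diag_part_full]).  Such an operator is obtained from the parts of any
    element of U of infinite rank by at most three brackets with off-diagonal
    operators ([upper_full], [skew_ideal_full]). *)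

(** * Sequences built step by step *)

Definition linear_of (K : comNzRingType) (U V : lmodType K) (f : U -> V)
    (lf : linear f) : {linear U -> V} :=
  HB.pack f (GRing.isLinear.Build K U V *:%R f lf).

(** A requirement on stage n that involves only the earlier stages can be met
    recursively; biorthogonal bases, hyperbolic bases and the compression of
    an operator to the identity are all built in this way. *)
Lemma dependent_choice (T : Type) (t0 : T) (E : nat -> (nat -> T) -> T -> Prop) :
    (forall n u v t, (forall m, (m < n)%N -> u m = v m) -> E n u t -> E n v t) ->
    (forall n u, (forall m, (m < n)%N -> E m u (u m)) -> exists t, E n u t) ->
  exists u : nat -> T, forall n, E n u (u n).
Proof.
move=> Eloc Eex.
have /choice[g gP] (s : seq T) : exists t,
    (forall m, (m < size s)%N -> E m (nth t0 s) (nth t0 s m)) ->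
    E (size s) (nth t0 s) t.
  have [/Eex[t Et]|nEs] := pselect (forall m, (m < size s)%N ->
    E m (nth t0 s) (nth t0 s m)); first by exists t.
  by exists t0.
pose S n := iter n (fun s => rcons s (g s)) [::].
have szS n : size (S n) = n by elim: n => //= n IH; rewrite size_rcons IH.
have nthS n k i : (i < n)%N -> nth t0 (S (n + k)%N) i = nth t0 (S n) i.
  move=> lt_in; elim: k => [|k IH]; first by rewrite addn0.
  by rewrite addnS /= nth_rcons szS ltn_addr.
have nthS' n i : (i < n)%N -> nth t0 (S n) i = nth t0 (S i.+1) i.
  by move=> lt_in; rewrite -(subnKC lt_in) nthS.
exists (fun n => nth t0 (S n.+1) n) => n.
have [m le_nm] := ubnP n; elim: m n le_nm => // m IH n le_nm.
rewrite /= nth_rcons szS ltnn eqxx.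
apply: (Eloc _ (nth t0 (S n))) => [i lt_in|]; first exact: nthS'.
rewrite -{1}(szS n); apply: gP => i; rewrite szS => lt_in.
rewrite nthS' //; apply: (Eloc _ (fun n => nth t0 (S n.+1) n)).
  by move=> j lt_ji; rewrite nthS' // (ltn_trans lt_ji).
by apply: IH; rewrite (leq_trans lt_in).
Qed.

(** * Operators of finite rank *)

Section FiniteRankOps.
Variables (K : comNzRingType) (V : lmodType K).
Implicit Types f g : {linear V -> V}.

Lemma finite_rankD f g : finite_rank f -> finite_rank g -> finite_rank (f + g).
Proof. by move=> F G; have := finite_rankP 1 F G; rewrite scale1r. Qed.

Lemma finite_rankZ a f : finite_rank f -> finite_rank (a *: f).
Proof. by move=> F; rewrite -[_ *: _]addr0; exact: finite_rankP (finite_rank0 V). Qed.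

Lemma finite_rank_compl f g : finite_rank g -> finite_rank (f \o g : {linear V -> V}).
Proof.
move=> /finite_rank_out[n [u [d gE]]].
apply: (@finite_rank_in _ _ _ n (f \o u) d) => x /=.
by rewrite gE linear_sum; apply: eq_bigr => i _; rewrite linearZ.
Qed.

Lemma finite_rank_compr f g : finite_rank f -> finite_rank (f \o g : {linear V -> V}).
Proof.
move=> /finite_rank_out[n [u [d fE]]].
by apply: (@finite_rank_in _ _ _ n u (d \o g)) => x /=; rewrite fE.
Qed.

End FiniteRankOps.

(** * Coordinates, transposes, and operators that are not finite rank plus scalar *)

Section Coordinates.
Variables (K : fieldType) (V : lmodType K).

(** A basis [e] together with its coordinate functionals [c]: operators are
    constructed from their values on [e] and compared through [c]. *)
Record coord_system (e : nat -> V) (c : nat -> {linear V -> K^o}) : Prop :=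
  CoordSystem {
    coordE : forall i j, c i (e j) = (i == j)%:R;
    coord_expansion : forall x, exists N, x = \sum_(i < N) c i x *: e i }.

Lemma biorthogonal_coord (e : nat -> V) (c : nat -> {linear V -> K^o})
    n (d : nat -> K) i :
    (forall i j, c i (e j) = (i == j)%:R) ->
  c i (\sum_(j < n) d j *: e j) = if (i < n)%N then d i else 0.
Proof.
move=> ceE; rewrite linear_sum /=; under eq_bigr => j _ do rewrite linearZ /= ceE.
case: ltnP => [lt_in|le_ni].
  rewrite (bigD1 (Ordinal lt_in)) //= eqxx [_ *: _]mulr1 big1 ?addr0 // => j.
  by rewrite -val_eqE /= eq_sym => /negbTE->; rewrite scaler0.
rewrite big1 // => j _; rewrite gtn_eqF ?scaler0 //.
exact: leq_trans (ltn_ord j) le_ni.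
Qed.

Section Theory.
Variables (e : nat -> V) (c : nat -> {linear V -> K^o}).
Hypothesis ec : coord_system e c.

Lemma coord_sum n (d : nat -> K) i :
  c i (\sum_(j < n) d j *: e j) = if (i < n)%N then d i else 0.
Proof. exact/biorthogonal_coord/coordE. Qed.

Lemma coord_bound x : exists N, forall n, (N <= n)%N ->
  x = \sum_(i < n) c i x *: e i /\ c n x = 0.
Proof.
have [N xE] := coord_expansion ec x; exists N => n le_Nn.
have cx0 i : (N <= i)%N -> c i x = 0.
  by move=> le_Ni; rewrite xE (coord_sum _ (fun j => c j x)) ltnNge le_Ni.
split; last exact: cx0.
rewrite {1}xE -(subnKC le_Nn) big_split_ord /= [X in _ = _ + X]big1 ?addr0 //.
by move=> i _; rewrite cx0 ?scale0r // leq_addr.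
Qed.

Lemma coord_support x : exists N, forall i, (N <= i)%N -> c i x = 0.
Proof. by have [N NP] := coord_bound x; exists N => i /NP[]. Qed.

Lemma coord_inj x y : (forall i, c i x = c i y) -> x = y.
Proof.
move=> cxy; have [N /(_ _ (leq_maxl _ _)) NP] := coord_bound x.
have [M /(_ _ (leq_maxr _ _)) MP] := coord_bound y.
rewrite (NP M).1 [RHS](MP N).1.
by apply: eq_bigr => i _; rewrite cxy.
Qed.

Lemma linear_coord_inj (U : lmodType K) (f g : {linear V -> U}) :
  (forall i, f (e i) = g (e i)) -> f = g.
Proof.
move=> fg; apply: linP => x; have [N xE] := coord_expansion ec x.
by rewrite xE !linear_sum; apply: eq_bigr => i _; rewrite !linearZ /= fg.
Qed.

Section Extension.
Variables (U : lmodType K) (y : nat -> U).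

Let deg x := sval (cid (coord_bound x)).
Let ext_fun x := \sum_(i < deg x) c i x *: y i.

Let ext_funE x n : (deg x <= n)%N -> ext_fun x = \sum_(i < n) c i x *: y i.
Proof.
move=> le_xn; rewrite -(subnKC le_xn) big_split_ord /=.
rewrite [X in _ = _ + X]big1 ?addr0 // => i _.
by rewrite (svalP (cid (coord_bound x)) _ (leq_addr _ _)).2 scale0r.
Qed.

Let ext_fun_linear : linear ext_fun.
Proof.
move=> a u v; set n := maxn (deg (a *: u + v)) (maxn (deg u) (deg v)).
rewrite !(@ext_funE _ n) ?leq_max ?leqnn ?orbT //.
rewrite (scaler_sumr a) -big_split /=; apply: eq_bigr => i _.
by rewrite linearP scalerDl scalerA.
Qed.

Let ext_exists : exists f : {linear V -> U}, forall n, f (e n) = y n.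
Proof.
exists (linear_of ext_fun_linear) => n.
rewrite -[LHS]/(ext_fun (e n)) (@ext_funE _ (maxn n.+1 (deg (e n)))) ?leq_maxr //.
have lt_n : (n < maxn n.+1 (deg (e n)))%N by rewrite leq_max leqnn.
rewrite (bigD1 (Ordinal lt_n)) //= (coordE ec) eqxx scale1r big1 ?addr0 // => i.
by rewrite -val_eqE (coordE ec) /= => /negbTE->; rewrite scale0r.
Qed.

Definition linear_ext : {linear V -> U} := sval (cid ext_exists).

Lemma linear_extE n : linear_ext (e n) = y n.
Proof. exact: (svalP (cid ext_exists)). Qed.

End Extension.

(** Finitely many vectors spanning the range have finitely many nonzero
    coordinates; conversely such a range lies in the span of finitely many
    basis vectors. *)
Lemma finite_rankE (f : {linear V -> V}) :
  finite_rank f <-> exists N, forall i, (N <= i)%N -> forall x, c i (f x) = 0.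
Proof.
split=> [/finite_rank_out[n [a [d fE]]]|[N fN]].
  have /choice[N NP] (j : 'I_n) := coord_support (a j).
  exists (\max_(j < n) N j)%N => i le_i x.
  rewrite fE linear_sum big1 // => j _; rewrite linearZ /= NP ?scaler0 //.
  by apply: leq_trans le_i; rewrite leq_bigmax.
apply: (@finite_rank_in _ _ _ N (fun i => e i) (fun x i => c i (f x))) => x.
apply: coord_inj => i; rewrite (coord_sum _ (fun j => c j (f x))).
by case: ltnP => // /fN ->.
Qed.

Lemma finite_rank_scalar a : finite_rank (a *: (idfun : {linear V -> V})) -> a = 0.
Proof.
move=> /finite_rankE[N /(_ N (leqnn _) (e N))].
by rewrite linZE linearZ /= (coordE ec) eqxx [_ *: _]mulr1.
Qed.

(** The matrices of [f] and [g] in the basis [e] are transposed to each other.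
    The columns of [g] being finite, [f] has a transpose exactly when the rows
    of its matrix are finite too. *)
Definition transposes (f g : {linear V -> V}) : Prop :=
  forall i j, c j (f (e i)) = c i (g (e j)).

Definition transposable (f : {linear V -> V}) : Prop :=
  exists g, transposes f g.

Lemma transposes_sym f g : transposes f g -> transposes g f.
Proof. by move=> fg i j; rewrite fg. Qed.

Lemma transposes_id : transposes idfun idfun.
Proof. by move=> i j; rewrite /= !(coordE ec) eq_sym. Qed.

Lemma transposes_lin a f f' g g' : transposes f f' -> transposes g g' ->
  transposes (a *: f + g) (a *: f' + g').
Proof.
by move=> ff' gg' i j; rewrite !linDE !linZE !linearP /= ff' gg'.
Qed.

(** Both sides are the same matrix product, a sum which is finite because the
    columns of [g] and of [f'] are. *)
Lemma transposes_comp f f' g g' : transposes f f' -> transposes g g' ->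
  transposes (f \o g) (g' \o f').
Proof.
move=> ff' gg' i j /=.
have [N /(_ _ (leq_maxl _ _)) NP] := coord_bound (g (e i)).
have [M /(_ _ (leq_maxr _ _)) MP] := coord_bound (f' (e j)).
rewrite (NP M).1 (MP N).1 !linear_sum.
apply: eq_bigr => k _; rewrite !linearZ /= -ff' gg'.
exact: mulrC.
Qed.

Lemma transposable_id : transposable idfun.
Proof. by exists idfun; exact: transposes_id. Qed.

Lemma transposable_lin a f g :
  transposable f -> transposable g -> transposable (a *: f + g).
Proof. by move=> [f' ff'] [g' gg']; exists (a *: f' + g'); exact: transposes_lin. Qed.

Lemma transposable_comp f g :
  transposable f -> transposable g -> transposable (f \o g).
Proof. by move=> [f' ff'] [g' gg']; exists (g' \o f'); exact: transposes_comp. Qed.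

(** In a lower triangular matrix with finite columns the rows are finite. *)
Lemma triangular_transposes (y : nat -> V) :
    (forall n i, (i < n)%N -> c i (y n) = 0) ->
  exists f f', transposes f f' /\ forall n, f (e n) = y n.
Proof.
move=> y0; exists (linear_ext y).
exists (linear_ext (fun m => \sum_(n < m.+1) c m (y n) *: e n)); split=> [i j|n].
  rewrite !linear_extE (coord_sum _ (fun n => c j (y n))) ltnS.
  by case: leqP => // /y0.
exact: linear_extE.
Qed.

(** An operator that maps a subspace of finite codimension into a
    finite-dimensional one has finite rank: for each functional it can be
    corrected by an operator of rank one. *)
Lemma finite_rank_on_kernels (f : {linear V -> V})
    (ls : seq {linear V -> K^o}) N :
    (forall x, all (fun l : {linear V -> K^o} => l x == 0) ls ->
       forall i, (N <= i)%N -> c i (f x) = 0) ->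
  finite_rank f.
Proof.
elim: ls f => [|l ls IH] f fls.
  by apply/finite_rankE; exists N => i le_Ni x; apply: fls.
have [[x0 lsx0 lx0]|nx0] := pselect (exists2 x,
    all (fun l : {linear V -> K^o} => l x == 0) ls & l x != 0); last first.
  apply: IH => x lsx; apply: fls; rewrite /= lsx andbT.
  by apply/negPn/negP => lx0; apply: nx0; exists x.
have lin_p : linear (fun x => (l x / l x0) *: f x0).
  move=> a x y; rewrite linearP /= -[a *: l x]/(a * l x).
  by rewrite mulrDl scalerDl -mulrA scalerA.
pose p : {linear V -> V} := linear_of lin_p.
have -> : f = (f - p) + p by rewrite subrK.
apply: finite_rankD.
  apply: IH => x lsx i le_Ni.
  rewrite linDE linNE -[p x]/((l x / l x0) *: f x0) -linearZ -linearB.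
  apply: fls le_Ni => /=; rewrite linearB linearZ /= [_ *: _]mulfVK // subrr eqxx /=.
  apply/allP => l' l'ls; rewrite linearB linearZ /=.
  by rewrite (eqP (allP lsx _ l'ls)) (eqP (allP lsx0 _ l'ls)) scaler0 subrr.
apply: (@finite_rank_in _ _ _ 1 (fun=> f x0) (fun x _ => l x / l x0)) => x.
by rewrite big_ord1.
Qed.

Definition finite_rank_plus_scalar (f : {linear V -> V}) : Prop :=
  exists a : K, finite_rank (f - a *: (idfun : {linear V -> V})).

(** If no such [x] and [w] existed then, on the common kernel of [ls], every
    finitely supported functional [w] without coordinates below [N] that kills
    [x] would kill [f x].  Taking for [w] the coordinate [c i] or a combination
    of [c i] and [c j] that kills [x], one sees that the coordinates of [f x]
    from [N] on are proportional to those of [x], with a ratio that does not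
    depend on [x]; so [f] would be a finite rank operator plus a scalar. *)
Lemma separating_functional (f : {linear V -> V}) (ls : seq {linear V -> K^o}) N :
    ~ finite_rank_plus_scalar f ->
  exists (x : V) (w : {linear V -> K^o}),
    [/\ all (fun l : {linear V -> K^o} => l x == 0) ls,
        forall i, (i < N)%N -> w (e i) = 0,
        exists M, forall i, (M <= i)%N -> w (e i) = 0,
        w x = 0 & w (f x) = 1].
Proof.
move=> nf; apply: contrapT => nxw.
pose X x := all (fun l : {linear V -> K^o} => l x == 0) ls.
have XP a x y : X x -> X y -> X (a *: x + y).
  move=> /allP Xx /allP Xy; apply/allP => l lls.
  by rewrite linearP /= (eqP (Xx _ lls)) (eqP (Xy _ lls)) scaler0 addr0.
have w0 x (w : {linear V -> K^o}) : X x ->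
    (forall i, (i < N)%N -> w (e i) = 0) ->
    (exists M, forall i, (M <= i)%N -> w (e i) = 0) -> w x = 0 -> w (f x) = 0.
  move=> Xx wN [M wM] wx; apply: contrapT => /eqP wfx; apply: nxw.
  exists x, ((w (f x))^-1 *: w); split=> //.
  - by move=> i /wN; rewrite linZE => ->; rewrite scaler0.
  - by exists M => i /wM; rewrite linZE => ->; rewrite scaler0.
  - by rewrite linZE wx scaler0.
  - by rewrite linZE [_ *: _]mulVf.
have w2 x i j a b : X x -> (N <= i)%N -> (N <= j)%N ->
    a * c i x + b * c j x = 0 -> a * c i (f x) + b * c j (f x) = 0.
  move=> Xx le_Ni le_Nj.
  have wE y : (a *: c i + b *: c j : {linear V -> K^o}) y = a * c i y + b * c j y.
    by rewrite linDE !linZE.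
  rewrite -!wE; apply: w0 => // [k lt_kN|].
    rewrite wE !(coordE ec) !gtn_eqF ?mulr0 ?addr0 //; exact: leq_trans lt_kN _.
  exists (i + j).+1 => k le_k; rewrite wE !(coordE ec) !ltn_eqF ?mulr0 ?addr0 //.
    by apply: leq_trans le_k; rewrite ltnS leq_addl.
  by apply: leq_trans le_k; rewrite ltnS leq_addr.
have w1 x i : X x -> (N <= i)%N -> c i x = 0 -> c i (f x) = 0.
  move=> Xx le_Ni cx; have := @w2 x i i 1 0 Xx le_Ni le_Ni.
  by rewrite !mul1r !mul0r !addr0; apply.
have [x0 [i [Xx0 le_Ni cx0]]] : exists x0 i, [/\ X x0, (N <= i)%N & c i x0 != 0].
  apply: contrapT => nx0.
  suff /finite_rank_scalar/eqP : finite_rank (1 *: (idfun : {linear V -> V})).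
    by rewrite oner_eq0.
  apply: (@finite_rank_on_kernels _ ls N) => x Xx i le_Ni; rewrite linZE scale1r /=.
  by apply: contrapT => /eqP cx; apply: nx0; exists x, i.
pose a := c i (f x0) / c i x0.
have aE x j : X x -> (N <= j)%N -> c i x = c i x0 -> c i (f x) = c i (f x0) ->
    c j (f x) = a * c j x.
  move=> Xx le_Nj cxE cfxE.
  have := @w2 x i j (- c j x) (c i x) Xx le_Ni le_Nj; rewrite mulNr mulrC addNr.
  move=> /(_ erefl)/eqP; rewrite mulNr addrC subr_eq0 cxE cfxE => /eqP eqij.
  by apply: (mulfI cx0); rewrite eqij /a; field.
apply: nf; exists a; apply: (@finite_rank_on_kernels _ ls N) => x Xx j le_Nj.
rewrite linDE linNE linZE /= linearB linearZ /=.
(* Subtracting [t *: x0] makes the i-th coordinate equal to that of [x0]. *)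
have [t tE] : exists t : K, c i x = (t + 1) * c i x0.
  by exists (c i x / c i x0 - 1); rewrite subrK divfK.
have Xy : X (- t *: x0 + x) by exact: XP.
have ciy : c i (- t *: x0 + x) = c i x0.
  by rewrite linearP /= -[_ *: _]/(- t * c i x0) tE; ring.
have cify : c i (f (- t *: x0 + x)) = c i (f x0).
  have Xz : X (- 1 *: x0 + (- t *: x0 + x)) by exact: XP.
  have := w1 _ i Xz le_Ni; rewrite linearP /= ciy !scaleN1r addNr => /(_ erefl).
  rewrite linearD linearN linearD linearN /= => /eqP.
  by rewrite addrC subr_eq0 => /eqP.
have := aE _ _ Xy le_Nj ciy cify; have := aE _ _ Xx0 le_Nj erefl erefl.
rewrite !linearP /= => -> /eqP.
rewrite -[_ *: _]/(- t * (a * c j x0)) -[_ *: c j x0]/(- t * c j x0).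
rewrite -[_ *: _]/(a * c j x) => /eqP eqj.
apply: (addrI (- t * (a * c j x0))).
by rewrite addrA eqj; ring.
Qed.

(** Choose recursively vectors x_n and functionals w_n with w_m (f x_n) equal
    to the Kronecker symbol and w_m x_n = 0.  Then [h] maps e_n to x_n, and the
    n-th coordinate of [k x] is w_n x.  Since x_n and w_n have no coordinates
    below n, the matrices of [h] and [k] have finite rows and columns. *)
Lemma compression_to_identity (f : {linear V -> V}) :
    ~ finite_rank_plus_scalar f ->
  exists h k, [/\ transposable h, transposable k,
    forall x, k (f (h x)) = x & forall x, k (h x) = 0].
Proof.
move=> nf.
pose T := (V * {linear V -> K^o})%type.
pose E (n : nat) (u : nat -> T) (t : T) : Prop :=
  [/\ forall i, (i < n)%N -> c i t.1 = 0 /\ t.2 (e i) = 0,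
      exists M, forall i, (M <= i)%N -> t.2 (e i) = 0,
      t.2 t.1 = 0 /\ t.2 (f t.1) = 1 &
      forall m, (m < n)%N -> [/\ (u m).2 t.1 = 0, (u m).2 (f t.1) = 0,
         t.2 (u m).1 = 0 & t.2 (f (u m).1) = 0]].
have [||u uE] := @dependent_choice T (0, 0) E.
- move=> n u v t uv [t1 t2 t3 t4]; split=> // m lt_mn.
  by rewrite -uv //; exact: t4.
- move=> n u _.
  have /choice[N NP] (x : V) := coord_support x.
  (* From [N1] on, the earlier x_m and f x_m have no coordinates left. *)
  pose N1 := (n + \max_(m < n) (N (u m).1 + N (f (u m).1)))%N.
  pose ls := [seq c i | i <- iota 0 n] ++ [seq (u i).2 | i <- iota 0 n]
     ++ [seq ((u i).2 \o f : {linear V -> K^o}) | i <- iota 0 n].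
  have [x [w [xls wN wM wx wfx]]] := separating_functional ls N1 nf.
  move: xls; rewrite !all_cat !all_map => /and3P[/allP xc /allP xu /allP xf].
  have in_n m : (m < n)%N -> m \in iota 0 n by rewrite mem_iota.
  exists (x, w); split=> //= [i lt_in|m lt_mn].
    split; last by apply: wN; rewrite ltn_addr.
    exact/eqP/xc/in_n.
  have wy y : (N y <= N1)%N -> w y = 0.
    move=> le_N; have [M /(_ _ (leqnn _)) [-> _]] := coord_bound y.
    rewrite linear_sum big1 // => i _; rewrite linearZ /=.
    case: (ltnP i N1) => [/wN ->|le_N1i]; first by rewrite scaler0.
    by rewrite NP ?scale0r // (leq_trans le_N).
  split; [exact/eqP/xu/in_n
         |exact/eqP/xf/in_n|apply: wy|apply: wy];
    apply: leq_trans (leq_addl _ _);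
    apply: leq_trans (leq_bigmax (Ordinal lt_mn)) => /=.
  + exact: leq_addr.
  + exact: leq_addl.
have /choice[M MP] n : exists M, forall i, (M <= i)%N -> (u n).2 (e i) = 0.
  by have [] := uE n.
(* The vector representing the functional w_n; it is the n-th column of the
   transpose of [k]. *)
pose y n := \sum_(i < M n) (u n).2 (e i) *: e i.
have cy n i : c i (y n) = (u n).2 (e i).
  rewrite (coord_sum _ (fun i => (u n).2 (e i))).
  by case: ltnP => // /MP.
have [h [h' [hh' hE]]] : exists f f', transposes f f' /\ forall n, f (e n) = (u n).1.
  by apply: triangular_transposes => n i lt_in; have [/(_ i lt_in)[]] := uE n.
have [k' [k [k'k kE]]] : exists f f', transposes f f' /\ forall n, f (e n) = y n.
  apply: triangular_transposes => n i lt_in; rewrite cy.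
  by have [/(_ i lt_in)[]] := uE n.
have ck n x : c n (k x) = (u n).2 x.
  apply: (congr1 (fun g : {linear V -> K^o} => g x)
    (@linear_coord_inj _ (c n \o k : {linear V -> K^o}) (u n).2 _)) => i /=.
  by rewrite -k'k kE cy.
exists h, k; split; [by exists h' | by exists k' | move=> x | move=> x].
  apply: (congr1 (fun g : {linear V -> V} => g x)
    (@linear_coord_inj _ (k \o f \o h : {linear V -> V}) idfun _)) => i /=.
  apply: coord_inj => j; rewrite ck hE (coordE ec).
  have [_ _ [_ uf] ulti] := uE i; have [_ _ _ ultj] := uE j.
  case: (ltngtP i j) => [/ultj[]|/ulti[]|->] //.
  by have [_ _ []] := uE j.
apply: (congr1 (fun g : {linear V -> V} => g x)
  (@linear_coord_inj _ (k \o h : {linear V -> V}) 0 _)) => i /=.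
apply: coord_inj => j; rewrite ck hE -[X in c j X]/(0 : V) linear0.
have [_ _ [uu _] ulti] := uE i; have [_ _ _ ultj] := uE j.
by case: (ltngtP i j) => [/ultj[]|/ulti[]|<-].
Qed.

End Theory.

(** A biorthogonal system is a basis as soon as the vectors of some basis can be
    expanded in it: this is how the recursive constructions are seen to
    exhaust the space. *)
Lemma coord_system_of_expansions (a e : nat -> V)
    (d c : nat -> {linear V -> K^o}) :
    coord_system a d -> (forall i j, c i (e j) = (i == j)%:R) ->
    (forall n, exists N, a n = \sum_(i < N) c i (a n) *: e i) ->
  coord_system e c.
Proof.
move=> ad ceE aE; split=> // x.
pose P y := exists N, forall n, (N <= n)%N -> y = \sum_(i < n) c i y *: e i.
suff [N NP] : P x by exists N; exact: NP.
have [M ->] := coord_expansion ad x.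
apply: (big_ind P) => [|y z [N yP] [N' zP]|i _].
- by exists 0%N => n _; rewrite big1 // => i _; rewrite linear0 scale0r.
- exists (maxn N N') => n; rewrite geq_max => /andP[/yP yE /zP zE].
  rewrite {1}yE {1}zE -big_split /=; apply: eq_bigr => i _.
  by rewrite linearD scalerDl.
- have [N aiE] := aE i; exists N => n le_Nn.
  under eq_bigr => j _ do rewrite linearZ /= -scalerA.
  rewrite -scaler_sumr; congr (_ *: _).
  rewrite {1}aiE -(subnKC le_Nn) big_split_ord /= [X in _ = _ + X]big1 ?addr0 //.
  move=> j _; rewrite [c (N + j)%N (a i)](_ : _ = 0) ?scale0r // aiE.
  by rewrite (biorthogonal_coord _ (fun j => c j (a i))) // ltnNge leq_addr.
Qed.

End Coordinates.

(** * The infinite swindle and Lie ideals of operator algebras *)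

Section Shifts.
Variables (K : fieldType) (V : lmodType K).
Variables (e : nat -> V) (c : nat -> {linear V -> K^o}).
Hypothesis ec : coord_system e c.

Local Notation transposes := (transposes e c).
Local Notation transposable := (transposable e c).

(** The isometries [even_in], [odd_in] and their transposes identify V with
    the direct sum of two copies of V. *)
Definition even_in : {linear V -> V} := linear_ext ec (fun n => e n.*2).
Definition odd_in : {linear V -> V} := linear_ext ec (fun n => e n.*2.+1).
Definition even_out : {linear V -> V} :=
  linear_ext ec (fun n => if odd n then 0 else e n./2).
Definition odd_out : {linear V -> V} :=
  linear_ext ec (fun n => if odd n then e n./2 else 0).

Lemma even_inE n : even_in (e n) = e n.*2.
Proof. exact: linear_extE. Qed.

Lemma odd_inE n : odd_in (e n) = e n.*2.+1.
Proof. exact: linear_extE. Qed.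

Lemma even_outE n : even_out (e n) = if odd n then 0 else e n./2.
Proof. exact: linear_extE. Qed.

Lemma odd_outE n : odd_out (e n) = if odd n then e n./2 else 0.
Proof. exact: linear_extE. Qed.

Let shiftE := (even_inE, odd_inE, even_outE, odd_outE).

Let lin_eq (f g : {linear V -> V}) (x : V) : f = g -> f x = g x.
Proof. by move=> ->. Qed.

Lemma even_inK x : even_out (even_in x) = x.
Proof.
apply: (@lin_eq (even_out \o even_in) idfun).
apply: (linear_coord_inj ec) => n /=.
by rewrite !shiftE odd_double doubleK.
Qed.

Lemma odd_inK x : odd_out (odd_in x) = x.
Proof.
apply: (@lin_eq (odd_out \o odd_in) idfun).
apply: (linear_coord_inj ec) => n /=.
by rewrite !shiftE /= odd_double uphalf_double.
Qed.

Lemma even_out_odd_in x : even_out (odd_in x) = 0.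
Proof.
apply: (@lin_eq (even_out \o odd_in) 0).
apply: (linear_coord_inj ec) => n /=.
by rewrite !shiftE /= odd_double.
Qed.

Lemma odd_out_even_in x : odd_out (even_in x) = 0.
Proof.
apply: (@lin_eq (odd_out \o even_in) 0).
apply: (linear_coord_inj ec) => n /=.
by rewrite !shiftE /= odd_double.
Qed.

Lemma even_odd_split x : even_in (even_out x) + odd_in (odd_out x) = x.
Proof.
apply: (@lin_eq ((even_in \o even_out : {linear V -> V}) +
  (odd_in \o odd_out : {linear V -> V})) idfun).
apply: (linear_coord_inj ec) => n; rewrite linDE /= !shiftE.
have nE := odd_double_half n; case: (odd n) nE => /= nE.
  by rewrite linear0 add0r shiftE -[in RHS]nE.
by rewrite linear0 addr0 shiftE -[in RHS]nE.
Qed.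

Lemma transposes_even : transposes even_in even_out.
Proof.
move=> i j; rewrite !shiftE.
have jE := odd_double_half j; case: (odd j) jE => /= jE.
  rewrite linear0 (coordE ec) -jE.
  by case: (_ =P _) => // /(congr1 odd); rewrite /= !odd_double.
by rewrite !(coordE ec) -{1}jE (inj_eq double_inj) eq_sym.
Qed.

Lemma transposes_odd : transposes odd_in odd_out.
Proof.
move=> i j; rewrite !shiftE.
have jE := odd_double_half j; case: (odd j) jE => /= jE.
  by rewrite !(coordE ec) -{1}jE eqSS (inj_eq double_inj) eq_sym.
rewrite linear0 (coordE ec) -jE.
by case: (_ =P _) => // /(congr1 odd); rewrite /= !odd_double.
Qed.

Lemma coord_even_out m x : c m (even_out x) = c m.*2 x.
Proof.
apply: (congr1 (fun g : {linear V -> K^o} => g x)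
  (@linear_coord_inj _ _ _ _ ec _ (c m \o even_out : {linear V -> K^o}) (c m.*2) _)).
by move=> i /=; rewrite -transposes_even even_inE !(coordE ec) eq_sym.
Qed.

Lemma coord_odd_out m x : c m (odd_out x) = c m.*2.+1 x.
Proof.
apply: (congr1 (fun g : {linear V -> K^o} => g x)
  (@linear_coord_inj _ _ _ _ ec _ (c m \o odd_out : {linear V -> K^o}) (c m.*2.+1) _)).
by move=> i /=; rewrite -transposes_odd odd_inE !(coordE ec) eq_sym.
Qed.

(** The operator that acts as [a] on the first [k] of the successive copies of V
    given by [odd_in^i \o even_in]. *)
Fixpoint copies (a : {linear V -> V}) (k : nat) : {linear V -> V} :=
  if k is k'.+1 then
    (even_in \o a \o even_out : {linear V -> V}) +
    (odd_in \o copies a k' \o odd_out : {linear V -> V})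
  else 0.

Arguments copies : simpl never.

Lemma copiesS a k x : copies a k.+1 x =
  even_in (a (even_out x)) + odd_in (copies a k (odd_out x)).
Proof. by []. Qed.

(** The operator acting as [a] on all the copies.  The infinite sum makes sense
    because e_n has a component in finitely many copies only. *)
Definition amplification (a : {linear V -> V}) : {linear V -> V} :=
  linear_ext ec (fun n => copies a n.+1 (e n)).

Lemma copies_stable a k n : (n < k)%N -> copies a k (e n) = amplification a (e n).
Proof.
rewrite /amplification linear_extE.
suff: forall m, copies a (n.+1 + m)%N (e n) = copies a n.+1 (e n).
  by move=> H lt_nk; rewrite -(subnKC lt_nk) H.
move=> m; have [k' le_nk] := ubnP n; elim: k' n m le_nk => // k' IH n m le_nk.
rewrite addSn !copiesS; congr (_ + _); rewrite shiftE.
have nE := odd_double_half n; case: (odd n) nE => /= nE; last by rewrite !linear0.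
have lt_n : (n./2 < n)%N by rewrite -[X in (_ < X)%N]nE add1n ltnS -addnn leq_addr.
congr (odd_in _); transitivity (copies a n./2.+1 (e n./2)).
  have := IH n./2 (n + m - n./2.+1)%N (leq_trans lt_n le_nk).
  by rewrite subnKC // ltn_addr.
have := IH n./2 (n - n./2.+1)%N (leq_trans lt_n le_nk).
by rewrite subnKC.
Qed.

Lemma amplificationE a x :
  amplification a x = even_in (a (even_out x)) + odd_in (amplification a (odd_out x)).
Proof.
apply: (@lin_eq _ ((even_in \o a \o even_out : {linear V -> V}) +
  (odd_in \o amplification a \o odd_out : {linear V -> V}))).
apply: (linear_coord_inj ec) => n; rewrite -(@copies_stable a n.+2) //.
rewrite copiesS -[RHS]/(even_in (a (even_out (e n)))
  + odd_in (amplification a (odd_out (e n)))); congr (_ + odd_in _).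
rewrite odd_outE; case: (odd n); last by rewrite !linear0.
by rewrite copies_stable // ltnS leq_half_double -addnn -addnS leq_addr.
Qed.

Lemma transposes_copies a a' k :
  transposes a a' -> transposes (copies a k) (copies a' k).
Proof.
move=> aa'; elim: k => [|k IH] i j; first by rewrite !lin0E !linear0.
rewrite !copiesS !linearD; congr (_ + _).
  have ss := transposes_even; have tt := transposes_sym ss.
  exact: (transposes_comp ec (transposes_comp ec ss aa') tt).
have ss := transposes_odd; have tt := transposes_sym ss.
exact: (transposes_comp ec (transposes_comp ec ss IH) tt).
Qed.

Lemma transposes_amplification a a' :
  transposes a a' -> transposes (amplification a) (amplification a').
Proof.
move=> aa' i j; rewrite -(@copies_stable a (i + j).+1) ?ltnS ?leq_addr //.
rewrite -(@copies_stable a' (i + j).+1) ?ltnS ?leq_addl //.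
exact: transposes_copies.
Qed.

(** Conjugating the amplification by the shift [odd_in] removes the first copy
    of [a]; this copy is in turn conjugate to [a]. *)
Lemma sum_of_commutators a :
  a = [lie odd_out, odd_in \o amplification a] - [lie even_in, a \o even_out].
Proof.
apply: linP => x; rewrite linDE linNE.
rewrite -[[lie odd_out, _] x]/(odd_out (odd_in (amplification a x))
  - odd_in (amplification a (odd_out x))).
rewrite -[[lie even_in, _] x]/(even_in (a (even_out x)) - a (even_out (even_in x))).
rewrite odd_inK even_inK (amplificationE a x).
by rewrite opprB addrK addrC subrK.
Qed.

(** The properties shared by End(V) and the algebra of row-and-column-finite
    matrices on which the description of Lie ideals rests. *)
Record operator_algebra (A : set {linear V -> V}) : Prop := OperatorAlgebra {
  algebra_subspace : is_subspace A;
  algebra_comp : forall a b, A a -> A b -> A (a \o b);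
  algebra_transposable : forall a, transposable a -> A a;
  algebra_amplification : forall a, A a -> A (amplification a) }.

Lemma operator_algebra_setT : operator_algebra setT.
Proof. by []. Qed.

Lemma operator_algebra_transposable : operator_algebra transposable.
Proof.
split=> [|a b|//|a [a' aa']].
- split=> [|a x y]; last exact: transposable_lin.
  by exists 0 => i j; rewrite !lin0E !linear0.
- exact: transposable_comp.
- by exists (amplification a'); exact: transposes_amplification.
Qed.

Section LieIdeals.
Local Notation "f ** g" := (f \o g : {linear V -> V})
  (at level 40, left associativity).
Hypothesis two_neq0 : (2%:R : K) != 0.
Variables A U : set {linear V -> V}.
Hypotheses (opA : operator_algebra A) (UA : U `<=` A) (subU : is_subspace U).
Hypothesis brU : forall a u, A a -> U u -> U [lie a, u].

Let A0 : A 0. Proof. by have [[]] := opA. Qed.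
Let Alin t a b : A a -> A b -> A (t *: a + b).
Proof. by have [[_ +] _ _ _] := opA; apply. Qed.
Let Acomp a b : A a -> A b -> A (a ** b). Proof. exact: algebra_comp. Qed.
Let Atr a : transposable a -> A a. Proof. exact: algebra_transposable. Qed.
Let Aampl a : A a -> A (amplification a). Proof. exact: algebra_amplification. Qed.
Let AB a b : A a -> A b -> A (a - b).
Proof. by move=> Aa Ab; rewrite addrC -scaleN1r; apply: Alin. Qed.
Let UD u v : U u -> U v -> U (u + v).
Proof. by have [_ +] := subU => /(_ 1 u v); rewrite scale1r. Qed.
Let UN u : U u -> U (- u).
Proof. by have [U0 /(_ (-1) u 0)] := subU; rewrite scaleN1r addr0 => H /H; apply. Qed.
Let brU' u a : U u -> A a -> U [lie u, a].
Proof. by move=> Uu Aa; rewrite bracketC; apply/UN/brU. Qed.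
Let lieE (a b : {linear V -> V}) v : [lie a, b] v = a (b v) - b (a v).
Proof. by []. Qed.

(** With k u h = 1 and k h = 0, set q = k u and g = u h - h q u h, so that
    q h = k g = 1 and q g = 0.  The successive brackets below show that U
    contains h A k, then h [A, A] q = h A q, then h A, then A. *)
Theorem lie_ideal_full u : U u -> ~ finite_rank_plus_scalar u -> U = A.
Proof.
move=> Uu nfu; apply/seteqP; split=> // a Aa.
have [h [k [/Atr Ah /Atr Ak kuh kh]]] := compression_to_identity ec nfu.
have Au := UA Uu.
(* The factor - 1/2 compensates for the two terms h y z k and h z y k that arise
   from the double bracket when y is a scalar. *)
have Uhk z : A z -> U (h ** z ** k).
  move=> Az; have -> : h ** z ** k =
      [lie [lie u, - 2^-1 *: (h ** k)], h ** z ** k].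
    apply: linP => x; rewrite !lieE !linZE /=.
    rewrite kh kuh linear0 scaler0 linear0 sub0r !scaleNr !opprK.
    rewrite [u (- _)]linearN [u (_ *: _)]linearZ /= [k (_ + _)]linearD.
    rewrite [k (- _)]linearN ![k (_ *: _)]linearZ /= kuh kh scaler0 addr0.
    rewrite [z (- _)]linearN [z (_ *: _)]linearZ /=.
    rewrite [h (- _)]linearN [h (_ *: _)]linearZ /= opprK.
    by rewrite -scalerDl -mulr2n -[_^-1 *+ 2]mulr_natr mulVf // scale1r.
  apply: (brU' _ (Acomp (Acomp Ah Az) Ak)); apply: (brU' Uu).
  by rewrite -[_ *: _]addr0; apply: Alin => //; exact: Acomp.
pose q : {linear V -> V} := k ** u.
pose g : {linear V -> V} := (u ** h) - (h ** q ** u ** h).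
have qh x : q (h x) = x by exact: kuh.
have kg x : k (g x) = x.
  by rewrite linDE linNE linearB /= kuh kh subr0.
have Aq : A q by exact: Acomp.
have Ag : A g.
  by apply: AB; do !apply: Acomp.
have Uhq z : A z -> U (h ** z ** q).
  have Uhlieq x y : A x -> A y -> U (h ** [lie x, y] ** q).
    move=> Ax Ay; have -> : h ** [lie x, y] ** q =
        [lie h ** x ** k, g ** y ** q] -
        [lie h ** (y ** x) ** k, g ** q].
      apply: linP => v; rewrite linDE linNE !lieE /= linearB.
      have cancel (t b d : V) : t - b = t - d - (b - d).
        by rewrite opprB addrA subrK.
      by rewrite !kg !kuh -cancel.
    apply: UD; first by apply: brU'; [exact: Uhk|do !apply: Acomp].
    apply: UN; apply: brU'; last exact: Acomp.
    by apply: Uhk; exact: Acomp.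
  move=> Az; rewrite (sum_of_commutators z).
  have -> (x y : {linear V -> V}) : h ** (x - y) ** q =
      (h ** x ** q) - (h ** y ** q).
    by apply: linP => v; rewrite linDE linNE -[LHS]/(h (x (q v) - y (q v))) linearB.
  apply: UD; [|apply: UN]; apply: Uhlieq.
  - by apply: Atr; exists odd_in; exact: transposes_sym transposes_odd.
  - apply: Acomp (Aampl Az).
    by apply: Atr; exists odd_out; exact: transposes_odd.
  - by apply: Atr; exists even_out; exact: transposes_even.
  - apply: Acomp Az _.
    by apply: Atr; exists even_in; exact: transposes_sym transposes_even.
have Uh z : A z -> U (h ** z).
  move=> Az; have -> : h ** z =
      [lie h ** idfun ** q, h ** z] + (h ** (z ** h) ** q).
    by apply: linP => v; rewrite linDE lieE /= kuh subrK.
  apply: UD; last by apply: Uhq; exact: Acomp.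
  apply: (brU' _ (Acomp Ah Az)); apply: Uhq.
  exact/Atr/transposable_id.
have -> : a = [lie q, h ** a] + (h ** a ** q).
  by apply: linP => v; rewrite linDE lieE /= kuh subrK.
by apply: UD; [exact: (brU Aq (Uh _ Aa))|exact: Uhq].
Qed.

End LieIdeals.

End Shifts.

(** * Bases and biorthogonal bases *)

Section Bases.
Variables (K : fieldType).

(** Coordinates of a vector are unique by freeness, hence linear in it. *)
Lemma coord_system_of_basis (V : lmodType K) (e : nat -> V) :
  is_basis e -> exists c, coord_system e c.
Proof.
move=> [free span].
pose rep x (d : nat -> K) := exists N, forall n, (N <= n)%N ->
  x = \sum_(i < n) d i *: e i /\ d n = 0.
have repP t x y d d' : rep x d -> rep y d' ->
    rep (t *: x + y) (fun i => t * d i + d' i).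
  move=> [N xP] [M yP]; exists (maxn N M) => n; rewrite geq_max => /andP[Nn Mn].
  have [{1}-> ->] := xP n Nn; have [{1}-> ->] := yP n Mn.
  rewrite mulr0 addr0; split=> //; rewrite scaler_sumr -big_split /=.
  by apply: eq_bigr => i _; rewrite scalerDl scalerA.
have rep_e i : rep (e i) (fun j => (i == j)%:R).
  exists i.+1 => n lt_in; rewrite ltn_eqF //; split=> //.
  rewrite (bigD1 (Ordinal lt_in)) //= eqxx scale1r big1 ?addr0 // => j.
  by rewrite -val_eqE /= eq_sym => /negbTE->; rewrite scale0r.
have rep0 : rep 0 (fun=> 0).
  by exists 0%N => n _; split=> //; rewrite big1 // => i _; rewrite scale0r.
have rep_uniq x d d' : rep x d -> rep x d' -> forall i, d i = d' i.
  move=> [N dP] [M d'P] i; pose n := maxn i.+1 (maxn N M).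
  have [|dE _] := dP n; first by rewrite /n !leq_max leqnn !orbT.
  have [|d'E _] := d'P n; first by rewrite /n !leq_max leqnn !orbT.
  have lt_in : (i < n)%N by rewrite /n leq_max leqnn.
  apply/eqP; rewrite -subr_eq0; apply/eqP.
  apply: (free n (fun i : 'I_n => d i - d' i) _ (Ordinal lt_in)).
  under eq_bigr => j _ do rewrite scalerBl.
  by rewrite sumrB -dE -d'E subrr.
have /choice[d dP] x : exists d, rep x d.
  have : lin_span (range e) x by rewrite span.
  move=> [n [a [k [ae ->]]]].
  apply: (big_ind (fun y => exists d, rep y d)) => [|y z [d yd] [d' zd']|i _].
  - by exists (fun=> 0).
  - by exists (fun i => 1 * d i + d' i); rewrite -[y]scale1r; exact: repP.
  - have [j _ <-] := ae i; exists (fun m => k i * (j == m)%:R + 0).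
    by rewrite -[_ *: _]addr0; exact: repP.
have d_linear i : linear (fun x => d x i : K^o).
  by move=> t x y; apply: (rep_uniq _ _ _ (dP _) (repP _ _ _ _ _ (dP _) (dP _))).
exists (fun i => linear_of (d_linear i)); split=> [i j|x].
  by rewrite eq_sym; exact: (rep_uniq _ _ _ (dP _) (rep_e _)).
by have [N /(_ _ (leqnn _))[]] := dP x; exists N.
Qed.

(** Gram-Schmidt: the new vector is the residual of [a] after subtraction of its
    components, or that of any vector outside the span so far when [a] already
    lies in it. *)
Lemma biorthogonal_step (V W : lmodType K) (p : {bilinear V -> W -> K^o})
    (e : nat -> V) (c : nat -> {linear V -> K^o}) n (v : nat -> V) (w : nat -> W) a :
    coord_system e c -> (forall x, (forall y, p x y = 0) -> x = 0) ->
    (forall i j, (i < n)%N -> (j < n)%N -> p (v i) (w j) = (i == j)%:R) ->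
  exists x y, [/\ p x y = 1,
    forall m, (m < n)%N -> p x (w m) = 0 /\ p (v m) y = 0 &
    a = \sum_(m < n) p a (w m) *: v m + p a y *: x].
Proof.
move=> ec nd vw.
pose r x := x - \sum_(m < n) p x (w m) *: v m.
have rw x j : (j < n)%N -> p (r x) (w j) = 0.
  move=> lt_jn; rewrite linearBl linear_sumlz (bigD1 (Ordinal lt_jn)) //=.
  rewrite linearZl_LR vw // eqxx [_ *: _]mulr1 big1 ?addr0 ?subrr // => i ne_ij.
  by rewrite linearZl_LR vw // -val_eqE /= in ne_ij *; rewrite (negbTE ne_ij) scaler0.
have [a1 [ra1 aP]] : exists a1, r a1 <> 0 /\ (r a = 0 \/ a1 = a).
  have [ra|ra] := pselect (r a = 0); last by exists a; split=> //; right.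
  apply: contrapT => na1; suff /(finite_rank_scalar ec)/eqP :
    finite_rank (1 *: (idfun : {linear V -> V})) by rewrite oner_eq0.
  apply: (@finite_rank_in _ _ _ n (fun i => v i) (fun x i => p x (w i))) => x.
  rewrite linZE scale1r /=; apply/eqP; rewrite -subr_eq0; apply/eqP.
  by apply: contrapT => rx; apply: na1; exists x; split=> //; left.
have [y0 py0] : exists y, p (r a1) y <> 0.
  apply: contrapT => H; apply: ra1; apply: nd => y.
  by apply: contrapT => py; apply: H; exists y.
pose y := (p (r a1) y0)^-1 *: (y0 - \sum_(m < n) p (v m) y0 *: w m).
have vy m : (m < n)%N -> p (v m) y = 0.
  move=> lt_mn; rewrite linearZr_LR linearBr linear_sumr (bigD1 (Ordinal lt_mn)) //=.
  rewrite linearZr_LR vw // eqxx [_ *: 1]mulr1 big1 ?addr0 ?subrr ?scaler0 // => i ne_im.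
  rewrite linearZr_LR vw // -val_eqE /= in ne_im *.
  by rewrite eq_sym (negbTE ne_im) scaler0.
have ry : p (r a1) y = 1.
  rewrite linearZr_LR linearBr linear_sumr big1 => [|i _].
    by rewrite subr0; apply: mulVf; apply/eqP.
  by rewrite linearZr_LR rw // scaler0.
exists (r a1), y; split=> // [m lt_mn|]; first by split; [exact: rw|exact: vy].
have aE : a = \sum_(m < n) p a (w m) *: v m + r a by rewrite addrC subrK.
have pay : p a y = p (r a) y.
  rewrite {1}aE linearDl linear_sumlz big1 ?add0r // => i _.
  by rewrite linearZl_LR vy // scaler0.
rewrite {1}aE pay; congr (_ + _); case: aP => [->|<-].
  by rewrite linear0l scale0r.
by rewrite ry scale1r.
Qed.

(** The even stages absorb a basis of V, the odd stages a basis of W. *)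
Lemma biorthogonal_bases (V W : lmodType K) (p : {bilinear V -> W -> K^o}) :
    countable_dim V -> countable_dim W -> nondegenerate_form p ->
  exists (v : nat -> V) (w : nat -> W),
    coord_system v (fun i => dual_of p (w i)) /\
    forall y, exists N, y = \sum_(i < N) p (v i) y *: w i.
Proof.
move=> [a /coord_system_of_basis[d ad]] [b /coord_system_of_basis[d' bd]] [ndl ndr].
pose q (y : W) (x : V) : K^o := p x y.
have q_bilinear : bilinear_for
    (GRing.Scale.Law.clone _ _ *:%R _) (GRing.Scale.Law.clone _ _ *:%R _) q.
  by split=> [x|y] t y1 y2; rewrite /q ?linearPr ?linearPl.
pose p' : {bilinear W -> V -> K^o} :=
  HB.pack q (bilinear_isBilinear.Build K W V K^o _ _ q q_bilinear).
pose E n (u : nat -> V * W) (t : V * W) := [/\ p t.1 t.2 = 1,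
  forall m, (m < n)%N -> p t.1 (u m).2 = 0 /\ p (u m).1 t.2 = 0 &
  if odd n then
    b n./2 = \sum_(m < n) p (u m).1 (b n./2) *: (u m).2 + p t.1 (b n./2) *: t.2
  else a n./2 = \sum_(m < n) p (a n./2) (u m).2 *: (u m).1 + p (a n./2) t.2 *: t.1].
have Eorth n u : (forall m, (m < n)%N -> E m u (u m)) -> forall i j,
    (i < n)%N -> (j < n)%N -> p (u i).1 (u j).2 = (i == j)%:R.
  move=> uE i j /uE[uii ui _] /uE[_ uj _].
  by case: (ltngtP i j) => [/uj[]|/ui[]|<-].
have [|n u /Eorth uE|u uE] := @dependent_choice _ (0, 0) E.
- move=> n u v t uv [t1 t2 t3]; split=> // [m lt_mn|]; first by rewrite -uv //; exact: t2.
  by case: ifP t3 => _ t3; rewrite {1}t3; congr (_ + _);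
    apply: eq_bigr => i _; rewrite uv.
- rewrite /E; case: (odd n).
    have [i j lt_in lt_jn|y [x [yx yxn bE]]] := @biorthogonal_step W V p' b d' n
        (fun i => (u i).2) (fun i => (u i).1) (b n./2) bd ndr.
      by rewrite [LHS]uE // eq_sym.
    by exists (x, y); split=> // m /yxn[].
  have [x [y [xy xyn aE]]] := @biorthogonal_step V W p a d n
    (fun i => (u i).1) (fun i => (u i).2) (a n./2) ad ndl uE.
  by exists (x, y).
have vw i j : p (u i).1 (u j).2 = (i == j)%:R.
  by apply: (Eorth (i + j).+1 u) => [m _||]; rewrite ?ltnS ?leq_addl ?leq_addr.
exists (fun i => (u i).1), (fun i => (u i).2); split.
  apply: (coord_system_of_expansions ad) => [i j|n].
    by rewrite [LHS]vw eq_sym.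
  have [_ _] := uE n.*2; rewrite odd_double doubleK => aE.
  by exists n.*2.+1; rewrite big_ord_recr.
suff : coord_system (fun i => (u i).2) (fun i => dual_of p' (u i).1).
  by move=> uu y; have [N yE] := coord_expansion uu y; exists N.
apply: (coord_system_of_expansions bd) => [i j|n]; first exact: vw.
have [_ _] := uE n.*2.+1; rewrite /= odd_double uphalf_double /= => bE.
by exists n.*2.+2; rewrite big_ord_recr.
Qed.

End Bases.

(** * Hyperbolic bases *)

Section HyperbolicBases.
Variables (K : fieldType) (V : lmodType K) (eps : bool).
Variable B : {hermitian V for eps & idfun}.
Hypothesis two_neq0 : (2%:R : K) != 0.

Local Notation sgn := ((-1) ^+ eps : K).

Let sgnK : sgn * sgn = 1. Proof. by rewrite -expr2 sqrr_sign. Qed.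

Let BC u v : B u v = sgn * B v u. Proof. exact: hermC. Qed.
Let BDl u v w : B (u + v) w = B u w + B v w. Proof. exact: linearDl. Qed.
Let BDr u v w : B w (u + v) = B w u + B w v. Proof. exact: linearDr. Qed.
Let BNl u w : B (- u) w = - B u w. Proof. exact: linearNl. Qed.
Let BNr u w : B w (- u) = - B w u. Proof. exact: linearNr. Qed.
Let BZl t u w : B (t *: u) w = t * B u w. Proof. exact: linearZl_LR. Qed.
Let BZr t u w : B w (t *: u) = t * B w u. Proof. exact: linearZr_LR. Qed.
Let B0l u : B 0 u = 0. Proof. exact: linear0l. Qed.
Let Bsuml n (F : 'I_n -> V) w : B (\sum_(i < n) F i) w = \sum_(i < n) B (F i) w.
Proof. exact: linear_sumlz. Qed.
Let Bsumr n (F : 'I_n -> V) w : B w (\sum_(i < n) F i) = \sum_(i < n) B w (F i).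
Proof. exact: linear_sumr. Qed.
Let BE := (BDl, BDr, BNl, BNr, BZl, BZr).

(** As for biorthogonal systems, with a residual [r0] that must be completed to
    a hyperbolic pair.  If [r0] is isotropic, a vector pairing to 1 with it can be
    made isotropic by adding a multiple of [r0].  Otherwise the form is symmetric,
    and there is a non-isotropic [z] orthogonal to [r0] and to the pairs so far;
    after normalisation to B(r0,r0) = 1 and B(z,z) = -1 the pair is
    r0 + z and (r0 - z) / 2. *)
Lemma hyperbolic_step (e : nat -> V) (c : nat -> {linear V -> K^o})
    n (x y : nat -> V) a :
    coord_system e c -> nondegenerate_form B ->
    (forall t : K, exists s, s ^+ 2 = t) ->
    (forall i j, (i < n)%N -> (j < n)%N ->
       [/\ B (x i) (y j) = (i == j)%:R, B (x i) (x j) = 0 & B (y i) (y j) = 0]) ->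
  exists s t, [/\ B s t = 1, B s s = 0 /\ B t t = 0,
    forall m, (m < n)%N -> [/\ B s (x m) = 0, B s (y m) = 0,
       B t (x m) = 0 & B t (y m) = 0] &
    a = \sum_(m < n) (B a (y m) *: x m + (sgn * B a (x m)) *: y m)
        + (B a t *: s + (sgn * B a s) *: t)].
Proof.
move=> ec [nd _] sqrtK xy.
pose pr v := \sum_(m < n) (B v (y m) *: x m + (sgn * B v (x m)) *: y m).
pose r v := v - pr v.
pose orth z := forall m, (m < n)%N -> B z (x m) = 0 /\ B z (y m) = 0.
have orth_pr z v : orth z -> B z (pr v) = 0.
  move=> zP; rewrite Bsumr big1 // => i _.
  by have [zx zy] := zP i (ltn_ord i); rewrite !BE zx zy !mulr0 addr0.
have orthP t z z' : orth z -> orth z' -> orth (t *: z + z').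
  move=> zP z'P m /[dup] /zP[zx zy] /z'P[zx' zy'].
  by rewrite !BE zx zy zx' zy' !mulr0 addr0.
have orthr v : orth (r v).
  move=> m lt_mn; split; rewrite BDl BNl Bsuml (bigD1 (Ordinal lt_mn)) //= !BE.
    have [xy1 xx _] := xy _ _ lt_mn lt_mn; rewrite xx [B (y m) _]BC xy1 eqxx.
    rewrite big1 => [|i ne_im].
      by rewrite mulr0 mulr1 add0r addr0 mulrAC sgnK mul1r subrr.
    have [xyi _ _] := xy _ _ lt_mn (ltn_ord i).
    have [_ xxi _] := xy _ _ (ltn_ord i) lt_mn.
    rewrite !BE xxi [B (y i) _]BC xyi; rewrite -val_eqE /= eq_sym in ne_im.
    by rewrite (negbTE ne_im) !mulr0 addr0.
  have [xy1 _ yy] := xy _ _ lt_mn lt_mn; rewrite yy xy1 eqxx.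
  rewrite big1 => [|i ne_im]; first by rewrite mulr0 mulr1 !addr0 subrr.
  have [xyi _ yyi] := xy _ _ (ltn_ord i) lt_mn.
  rewrite !BE yyi xyi; rewrite -val_eqE /= in ne_im.
  by rewrite (negbTE ne_im) !mulr0 addr0.
(* V is infinite-dimensional: some coordinate vanishes on the pairs so far and
   on one more vector. *)
have far (z : V) : exists i, [/\ c i z = 0,
    forall m, (m < n)%N -> c i (x m) = 0 & forall m, (m < n)%N -> c i (y m) = 0].
  have /choice[N NP] (v : V) := coord_support ec v.
  exists (N z + \max_(m < n) (N (x m) + N (y m)))%N; split=> [|m lt_mn|m lt_mn];
    apply: NP; first exact: leq_addr.
    apply: leq_trans (leq_addl _ _); apply: leq_trans (leq_bigmax (Ordinal lt_mn)).
    exact: leq_addr.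
  apply: leq_trans (leq_addl _ _); apply: leq_trans (leq_bigmax (Ordinal lt_mn)).
  exact: leq_addl.
have not_spanned (z : V) (al : V -> K) : ~ forall v, v = pr v + al v *: z.
  move=> vE; have [i [cz cx cy]] := far z.
  have /eqP := coordE ec i i; rewrite eqxx {1}(vE (e i)) linearD linearZ /= cz scaler0.
  rewrite addr0 linear_sum big1 1?eq_sym ?oner_eq0 // => m _.
  by rewrite linearD !linearZ /= cx // cy // !scaler0 addr0.
(* It remains to complete a nonzero residual to a hyperbolic pair. *)
suff pair r0 : orth r0 -> r0 <> 0 -> exists s t, [/\ orth s /\ orth t, B s t = 1,
    B s s = 0, B t t = 0 & r0 = B r0 t *: s + (sgn * B r0 s) *: t].
  have [a1 [ra1 aP]] : exists a1, r a1 <> 0 /\ (r a = 0 \/ a1 = a).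
    have [ra|ra] := pselect (r a = 0); last by exists a; split=> //; right.
    apply: contrapT => na1; apply: (@not_spanned 0 (fun=> 0)) => v.
    rewrite scaler0 addr0; apply/eqP; rewrite -subr_eq0; apply/eqP.
    by apply: contrapT => rv; apply: na1; exists v; split=> //; left.
  have [s [t [[os ot] st ss tt rE]]] := pair _ (orthr a1) ra1.
  exists s, t; split=> // [m lt_mn|].
    by have [-> ->] := os _ lt_mn; have [-> ->] := ot _ lt_mn.
  have aE : a = pr a + r a by rewrite addrC subrK.
  have Bar z : orth z -> B a z = B (r a) z.
    by move=> oz; rewrite {1}aE BDl [B (pr a) z]BC orth_pr // mulr0 add0r.
  rewrite {1}aE !Bar //; congr (_ + _).
  by case: aP => [->|<- //]; rewrite !B0l mulr0 !scale0r addr0.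
move=> or0 nr0.
have Br0 z v : orth z -> B z (r v) = B z v.
  by move=> oz; rewrite BDr BNr orth_pr // subr0.
have [Brr|Brr] := eqVneq (B r0 r0) 0.
  have [z Bz] : exists z, B r0 z <> 0.
    apply: contrapT => H; apply: nr0; apply: nd => z.
    by apply: contrapT => Bz; apply: H; exists z.
  have [z1 [oz1 Brz]] : exists z1, orth z1 /\ B r0 z1 = 1.
    exists ((B r0 z)^-1 *: r z); split=> [m /(orthr z)[rx ry]|].
      by rewrite !BZl rx ry !mulr0.
    by rewrite BZr Br0 // mulVf //; exact/eqP.
  have Bzz : sgn * B z1 z1 = B z1 z1 by rewrite -BC.
  exists r0, (- (2^-1 * B z1 z1) *: r0 + z1); split=> //.
  - by split=> //; exact: orthP.
  - by rewrite !BE Brr Brz mulr0 add0r.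
  - rewrite !BE Brr Brz [B z1 r0]BC Brz.
    rewrite (_ : _ + _ = 2^-1 * (B z1 z1 - sgn * B z1 z1)); last by field.
    by rewrite Bzz subrr mulr0.
  - by rewrite !BE Brr Brz !mulr0 scale0r addr0 add0r scale1r.
have sgn1 : sgn = 1.
  by apply: (mulIf Brr); rewrite -BC mul1r.
have Bsym u v : B u v = B v u by rewrite BC sgn1 mul1r.
have [z [oz Bzr Bzz]] : exists z, [/\ orth z, B z r0 = 0 & B z z != 0].
  apply: contrapT => nz.
  have iso z : orth z -> B z r0 = 0 -> B z z = 0.
    by move=> oz Bzr; apply: contrapT => /eqP Bzz; apply: nz; exists z.
  have iso2 z z' : orth z -> B z r0 = 0 -> orth z' -> B z' r0 = 0 -> B z z' = 0.
    move=> oz Bz oz' Bz'.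
    have : B (1 *: z + z') (1 *: z + z') = 0.
      by apply: iso; [exact: orthP|rewrite !BE Bz Bz' mulr0 addr0].
    rewrite !BE !mul1r (iso z) // (iso z') // (Bsym z' z) add0r addr0 -mulr2n.
    by rewrite -mulr_natr => /eqP; rewrite mulf_eq0 (negbTE two_neq0) orbF => /eqP.
  pose q v := - (B (r v) r0 / B r0 r0) *: r0 + r v.
  have oq v : orth (q v) by exact: orthP.
  have Bq v : B (q v) r0 = 0 by rewrite !BE mulNr divfK // addNr.
  apply: (@not_spanned r0 (fun v => B (r v) r0 / B r0 r0)) => v.
  suff /eqP : q v = 0.
    by rewrite /q scaleNr addrC subr_eq0 => /eqP <-; rewrite addrC subrK.
  apply: nd => w; rewrite -Br0 //.
  have := iso2 _ _ (oq v) (Bq v) (oq w) (Bq w).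
  by rewrite {2}/q BDr BZr Bq mulr0 add0r.
have [al al2] := sqrtK (B r0 r0); have [be be2] := sqrtK (- B z z).
have al0 : al != 0 by apply: contraNneq Brr => al0; rewrite -al2 al0 expr0n.
have be0 : be != 0.
  by apply: contraNneq Bzz => be0; rewrite -[B z z]opprK -be2 be0 expr0n oppr0.
have BzzE : B z z = - be ^+ 2 by rewrite be2 opprK.
exists (al^-1 *: r0 + (be^-1 *: z + 0)), (2^-1 *: (al^-1 *: r0 + (- be^-1 *: z + 0)) + 0).
have o0 : orth 0 by move=> m _; rewrite !B0l.
split.
- by split; do !apply: (orthP).
- by rewrite !addr0 !BE (Bsym r0 z) Bzr -al2 BzzE; field; rewrite two_neq0 al0 be0.
- by rewrite !addr0 !BE (Bsym r0 z) Bzr -al2 BzzE; field; rewrite al0 be0.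
- by rewrite !addr0 !BE (Bsym r0 z) Bzr -al2 BzzE; field; rewrite two_neq0 al0 be0.
- rewrite !addr0 !BE (Bsym r0 z) Bzr -al2 sgn1 !mulr0 !addr0 mul1r.
  rewrite !(scalerDr, scalerA) addrACA -!scalerDl -[LHS]addr0 -{1}[r0]scale1r.
  congr (_ + _).
    by congr (_ *: _); field; rewrite two_neq0 al0.
  by rewrite -[LHS](scale0r z); congr (_ *: _); field; rewrite two_neq0 al0 be0.
Qed.

(** The basis vectors e_2m and e_(2m+1) form the m-th hyperbolic pair; the
    formulas for the coordinates say that distinct pairs are orthogonal. *)
Definition hyperbolic_system (e : nat -> V) (c : nat -> {linear V -> K^o}) : Prop :=
  coord_system e c /\
  forall v m, c m.*2 v = B v (e m.*2.+1) /\ c m.*2.+1 v = sgn * B v (e m.*2).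

Lemma big_ord_double n (F : nat -> V) :
  \sum_(i < n.*2) F i = \sum_(m < n) (F m.*2 + F m.*2.+1).
Proof.
elim: n => [|n IH]; first by rewrite !big_ord0.
by rewrite doubleS !big_ord_recr /= IH addrA.
Qed.

(** Stage n makes sure that the n-th vector of a given basis is spanned. *)
Lemma hyperbolic_basis :
    countable_dim V -> nondegenerate_form B ->
    (forall t : K, exists s, s ^+ 2 = t) ->
  exists e c, hyperbolic_system e c.
Proof.
move=> [a /coord_system_of_basis[d ad]] nd sqrtK.
pose E n (u : nat -> V * V) (t : V * V) := [/\ B t.1 t.2 = 1,
  B t.1 t.1 = 0 /\ B t.2 t.2 = 0,
  forall m, (m < n)%N -> [/\ B t.1 (u m).1 = 0, B t.1 (u m).2 = 0,
     B t.2 (u m).1 = 0 & B t.2 (u m).2 = 0] &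
  a n = \sum_(m < n) (B (a n) (u m).2 *: (u m).1 + (sgn * B (a n) (u m).1) *: (u m).2)
        + (B (a n) t.2 *: t.1 + (sgn * B (a n) t.1) *: t.2)].
have Eorth n u : (forall m, (m < n)%N -> E m u (u m)) -> forall i j,
    (i < n)%N -> (j < n)%N ->
    [/\ B (u i).1 (u j).2 = (i == j)%:R, B (u i).1 (u j).1 = 0 & B (u i).2 (u j).2 = 0].
  move=> uE i j /uE[ui1 [ui2 ui3] ui _] /uE[uj1 _ uj _].
  case: (ltngtP i j) => [/uj[j1 j2 j3 j4]|/ui[]|<-] //.
  by rewrite BC j3 [B (u i).1 _]BC j1 [B (u i).2 _]BC j4 !mulr0.
have [|n u /Eorth uE|u uE] := @dependent_choice _ (0, 0) E.
- move=> n u v t uv [t1 t2 t3 t4]; split=> // [m lt_mn|].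
    by rewrite -uv //; exact: t3.
  by rewrite {1}t4; congr (_ + _); apply: eq_bigr => i _; rewrite uv.
- have [s [t [st [ss tt] or aE]]] := @hyperbolic_step a d n (fun i => (u i).1)
    (fun i => (u i).2) (a n) ad nd sqrtK uE.
  by exists (s, t).
have uu i j : [/\ B (u i).1 (u j).2 = (i == j)%:R, B (u i).1 (u j).1 = 0
    & B (u i).2 (u j).2 = 0].
  by apply: (Eorth (i + j).+1 u) => [m _||]; rewrite ?ltnS ?leq_addl ?leq_addr.
pose e i := if odd i then (u i./2).2 else (u i./2).1.
have e_even m : e m.*2 = (u m).1 by rewrite /e odd_double doubleK.
have e_odd m : e m.*2.+1 = (u m).2 by rewrite /e /= odd_double uphalf_double.
pose f i v : K^o := if odd i then sgn * B v (u i./2).1 else B v (u i./2).2.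
have f_linear i : linear (f i).
  by move=> t v w; rewrite /f; case: (odd i); rewrite !BE // mulrDr mulrCA.
pose c i : {linear V -> K^o} := linear_of (f_linear i).
have cE i v : c i v = f i v by [].
have c_even m v : c m.*2 v = B v (u m).2 by rewrite cE /f odd_double doubleK.
have c_odd m v : c m.*2.+1 v = sgn * B v (u m).1.
  by rewrite cE /f /= odd_double uphalf_double.
exists e, c; split=> [|v m]; last by rewrite c_even c_odd e_even e_odd.
apply: (coord_system_of_expansions ad) => [i j|n].
  have iE := odd_double_half i; have jE := odd_double_half j.
  have [u1 u2 u3] := uu j./2 i./2; have [u4 _ _] := uu i./2 j./2.
  rewrite -{2}iE -{2}jE -{1}iE -{1}jE.
  case: (odd i) {iE}; case: (odd j) {jE}; rewrite ?add1n ?add0n.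
  - rewrite c_odd e_odd BC u4 mulrA sgnK mul1r eqSS (inj_eq double_inj) //.
  - rewrite c_odd e_even u2 mulr0.
    by case: (_ =P _) => // /(congr1 odd); rewrite /= !odd_double.
  - rewrite c_even e_odd u3.
    by case: (_ =P _) => // /(congr1 odd); rewrite /= !odd_double.
  - by rewrite c_even e_even u1 (inj_eq double_inj) eq_sym.
exists n.+1.*2; rewrite (big_ord_double _ (fun i => c i (a n) *: e i)).
have [_ _ _ {1}->] := uE n; rewrite big_ord_recr /=.
have pairE m : c m.*2 (a n) *: e m.*2 + c m.*2.+1 (a n) *: e m.*2.+1 =
    B (a n) (u m).2 *: (u m).1 + (sgn * B (a n) (u m).1) *: (u m).2.
  by rewrite c_even c_odd e_even e_odd.
by congr (_ + _); [apply: eq_bigr => m _|]; rewrite -pairE.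
Qed.

End HyperbolicBases.

(** * Simplicity of quotients *)

Section Quotients.
Variables (K : comNzRingType) (L : lieAlgType K).

(** The inverse image of an ideal of the quotient is an ideal; if it is larger
    than [I] it has to be everything. *)
Lemma simple_lie_quot (I : lieIdeal L) :
    (exists x y, ~ ideal_set I [lie x, y]) ->
    (forall J : set L, is_subspace J -> (forall x y, J y -> J [lie x, y]) ->
       (exists2 u, J u & ~ ideal_set I u) -> J = setT) ->
  simple_lie (lie_quot I).
Proof.
have pi0 (x : L) : \pi_(lie_quot I)%qT x = 0 -> ideal_set I x.
  rewrite -(pi_zeroE I) => /pi_eqP; rewrite subr0 => /set_mem; exact.
move=> [x [y nIxy]] Imax; split.
  exists (\pi_(lie_quot I)%qT x), (\pi_(lie_quot I)%qT y).
  by rewrite -pi_bracketE => /pi0.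
move=> N; have [N0 Nlin] := ideal_subspace N.
pose J : set L := [set x | ideal_set N (\pi_(lie_quot I)%qT x)].
have [[u Nu nIu]|nu] := pselect (exists2 u, J u & ~ ideal_set I u); last first.
  left; apply/seteqP; split=> [q Nq|q ->] //; have [z zE] := pi_surj q.
  rewrite zE /= -(pi_zeroE I); apply: pi_eq; rewrite subr0; apply/mem_set.
  by apply: contrapT => nIz; apply: nu; exists z => //; rewrite /J /= -zE.
right; apply/seteqP; split=> // q _; have [z ->] := pi_surj q.
suff JT : J = setT by have : J z by rewrite JT.
apply: Imax; [split|move=> a b|by exists u].
- by rewrite /J /= pi_zeroE.
- by move=> a b d Jb Jd; rewrite /J /= pi_addE pi_scaleE; exact: Nlin.
- by rewrite /J /= pi_bracketE; exact: ideal_bracket.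
Qed.

End Quotients.

Lemma simple_sub_lie_quot (K : comNzRingType) (L : lieAlgType K)
    (S : lieSubalgebra L) (I : lieIdeal (sub_lie S)) :
    (exists x y, [/\ subalgebra_set S x, subalgebra_set S y & ~ (val @` I) [lie x, y]]) ->
    (forall U : set L, U `<=` (S : set L) -> is_subspace U ->
       (forall x u, subalgebra_set S x -> U u -> U [lie x, u]) ->
       (exists2 u, U u & ~ (val @` I) u) -> U = subalgebra_set S) ->
  simple_lie (lie_quot I).
Proof.
have valS (z : sub_lie S)  : subalgebra_set S (val z) by exact/set_mem/(valP z).
have lift x : subalgebra_set S x -> exists z : sub_lie S, val z = x.
  by move=> Sx; exists (Sub x (mem_set Sx)); exact: SubK.
have inj (z z' : sub_lie S) : val z = val z' -> z = z' by exact: val_inj.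
move=> [x [y [/lift[x' x'E] /lift[y' y'E] nIxy]]] Imax; apply: simple_lie_quot.
  exists x', y' => Ixy; apply: nIxy; exists [lie x', y'] => //.
  by rewrite val_bracket x'E y'E.
move=> J [J0 Jlin] Jbr [u Ju nIu]; apply/seteqP; split=> // z _.
suff JS : val @` J = subalgebra_set S.
  by have : (val @` J) (val z) by [rewrite JS]; move=> [z' Jz' /inj <-].
apply: Imax => [_ [a _ <-] //||w _ /lift[a <-] [b Jb <-]|].
- split=> [|t _ _ [a Ja <-] [b Jb <-]]; first by exists 0 => //; exact: val_lie0.
  by exists (t *: a + b); [exact: Jlin | exact: val_lieP].
- by exists [lie a, b]; [exact: Jbr|].
- by exists (val u); [exists u|move=> [v Iv /inj vu]; apply: nIu; rewrite -vu].
Qed.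

(** * Ideals of the algebra of skew operators *)

Section Skew.
Variables (K : fieldType) (V : lmodType K) (eps : bool).
Variable B : {hermitian V for eps & idfun}.
Hypothesis two_neq0 : (2%:R : K) != 0.
Variables (e : nat -> V) (c : nat -> {linear V -> K^o}).
Hypothesis hB : hyperbolic_system B e c.

Let ec : coord_system e c := hB.1.
Local Notation sgn := ((-1) ^+ eps : K).
Local Notation transposes := (transposes e c).
Local Notation transposable := (transposable e c).
Local Notation ein := (even_in ec).
Local Notation oin := (odd_in ec).
Local Notation eout := (even_out ec).
Local Notation oout := (odd_out ec).
Local Notation "f ** g" := (f \o g : {linear V -> V})
  (at level 40, left associativity).

Let sgnK : sgn * sgn = 1. Proof. by rewrite -expr2 sqrr_sign. Qed.
Let BC u v : B u v = sgn * B v u. Proof. exact: hermC. Qed.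

Let B_odd v m : B v (e m.*2.+1) = c m (eout v).
Proof. by rewrite coord_even_out; have [_ /(_ v m)[]] := hB. Qed.

Let B_even v m : B v (e m.*2) = sgn * c m (oout v).
Proof.
by rewrite coord_odd_out; have [_ /(_ v m)[_ ->]] := hB; rewrite mulrA sgnK mul1r.
Qed.

(** The splitting of V into [even_in] and [odd_in] is its splitting into two
    isotropic halves; these are the parts of an operator of degree 0, 2 and -2
    for the grading defined by [diag_op 1 (-1)]. *)
Definition diag_op (a d : {linear V -> V}) : {linear V -> V} :=
  ein ** a ** eout + oin ** d ** oout.
Definition upper_op (b : {linear V -> V}) : {linear V -> V} := ein ** b ** oout.
Definition lower_op (g : {linear V -> V}) : {linear V -> V} := oin ** g ** eout.

(** The off-diagonal blocks of a skew operator are antisymmetric matrices for a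
    symmetric form and symmetric matrices for an antisymmetric one. *)
Definition sgn_skew (b : {linear V -> V}) : Prop := transposes b (- sgn *: b).

(** The defect of skewness is bilinear and vanishes on pairs of basis vectors. *)
Lemma skewM_basis (X : {linear V -> V}) :
  (forall i j, B (X (e i)) (e j) + sgn * B (X (e j)) (e i) = 0) -> skewM_set B X.
Proof.
move=> Xe v w; rewrite [B v (X w)]BC.
pose h u x : K^o := B (X u) x + sgn * B (X x) u.
have hC u x : h x u = sgn * h u x.
  by rewrite /h mulrDr mulrA sgnK mul1r addrC.
have h_linear x : linear (h^~ x).
  move=> t u u'; rewrite /h linearP linearPl linearPr /=.
  by rewrite -[t *: (_ + _)]/(t * (_ + _)); ring.
have hex i u : h u (e i) = 0.
  apply: (congr1 (fun g : {linear V -> K^o} => g u)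
    (@linear_coord_inj _ _ _ _ ec _ (linear_of (h_linear (e i))) 0 _)) => j.
  exact: Xe.
apply: (congr1 (fun g : {linear V -> K^o} => g v)
  (@linear_coord_inj _ _ _ _ ec _ (linear_of (h_linear w)) 0 _)) => j.
by rewrite -[LHS]/(h (e j) w) hC hex mulr0.
Qed.

(** Skewness on basis vectors, read off for the four parities of the indices. *)
Lemma skewM_blocks (X : {linear V -> V}) : skewM_set B X <->
  [/\ transposes (eout ** X ** ein) (- (oout ** X ** oin)),
      sgn_skew (eout ** X ** oin) & sgn_skew (oout ** X ** ein)].
Proof.
have sgnI : injective ( *%R sgn) by apply: mulfI; rewrite signr_eq0.
split=> [XB|[tra trb trg]].
  have Xe i j : B (X (e i)) (e j) = - sgn * B (X (e j)) (e i).
    by apply/eqP; rewrite mulNr -addr_eq0 -BC; apply/eqP; exact: XB.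
  split=> n m; rewrite ?linNE ?linZE ?linearN ?linearZ /= -?[_ *: _]/(_ * _).
  - have := Xe n.*2 m.*2.+1; rewrite B_odd B_even even_inE odd_inE.
    by move=> ->; rewrite mulrA mulNr sgnK mulN1r.
  - by have := Xe n.*2.+1 m.*2.+1; rewrite !B_odd !odd_inE.
  - have := Xe n.*2 m.*2; rewrite !B_even !even_inE mulrCA.
    exact: sgnI.
apply: skewM_basis => i j; apply/eqP; rewrite addr_eq0 -mulNr; apply/eqP.
have iE := odd_double_half i; have jE := odd_double_half j.
rewrite -iE -jE; case: (odd i) {iE}; case: (odd j) {jE}; rewrite ?add1n ?add0n.
- by have := trb i./2 j./2; rewrite linZE linearZ /= !odd_inE !B_odd.
- have := tra j./2 i./2; rewrite linNE linearN /= even_inE odd_inE B_odd B_even => ->.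
  by rewrite mulrN mulNr opprK.
- have := tra i./2 j./2; rewrite linNE linearN /= even_inE odd_inE B_odd B_even => ->.
  by rewrite mulrA mulNr sgnK mulN1r.
- have := trg i./2 j./2; rewrite linZE linearZ /= !even_inE !B_even => ->.
  by rewrite mulrCA.
Qed.

Let shiftK := (even_inK ec, odd_inK ec, even_out_odd_in ec, odd_out_even_in ec).

Let diagE a d x : diag_op a d x = ein (a (eout x)) + oin (d (oout x)).
Proof. by []. Qed.

Lemma blocks_diag a d :
  [/\ eout ** diag_op a d ** ein = a, oout ** diag_op a d ** oin = d,
      eout ** diag_op a d ** oin = 0 & oout ** diag_op a d ** ein = 0].
Proof.
by split; apply: linP => x; rewrite -[LHS]/(_ (diag_op a d (_ x))) diagE !shiftK
  !linear0 ?add0r ?addr0 ?shiftK.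
Qed.

Lemma blocks_upper b :
  [/\ eout ** upper_op b ** ein = 0, oout ** upper_op b ** oin = 0,
      eout ** upper_op b ** oin = b & oout ** upper_op b ** ein = 0].
Proof. by split; apply: linP => x; rewrite /= !shiftK ?linear0 ?shiftK. Qed.

Lemma blocks_lower g :
  [/\ eout ** lower_op g ** ein = 0, oout ** lower_op g ** oin = 0,
      eout ** lower_op g ** oin = 0 & oout ** lower_op g ** ein = g].
Proof. by split; apply: linP => x; rewrite /= !shiftK ?linear0 ?shiftK. Qed.

Lemma block_decomposition (X : {linear V -> V}) : X =
  diag_op (eout ** X ** ein) (oout ** X ** oin)
  + upper_op (eout ** X ** oin) + lower_op (oout ** X ** ein).
Proof.
apply: linP => x; rewrite !linDE /=.
rewrite -{1}(even_odd_split ec x) linearD.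
rewrite -{1}(even_odd_split ec (X (ein (eout x)))).
rewrite -{1}(even_odd_split ec (X (oin (oout x)))).
by rewrite -!addrA; congr (_ + _); rewrite addrC -addrA addrCA addrC -!addrA.
Qed.

Let transposes0 : transposes 0 0.
Proof. by move=> i j; rewrite !lin0E !linear0. Qed.

Let sgn_skew0 : sgn_skew 0.
Proof. by rewrite /sgn_skew scaler0. Qed.

Lemma skewM_diag a a' : transposes a a' -> skewM_set B (diag_op a (- a')).
Proof.
move=> aa'; apply/skewM_blocks; have [-> -> -> ->] := blocks_diag a (- a').
by rewrite opprK.
Qed.

Lemma skewM_upper b : skewM_set B (upper_op b) <-> sgn_skew b.
Proof.
rewrite skewM_blocks; have [-> -> -> ->] := blocks_upper b.
by rewrite oppr0; split=> [[]|].
Qed.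

Lemma skewM_lower g : skewM_set B (lower_op g) <-> sgn_skew g.
Proof.
rewrite skewM_blocks; have [-> -> -> ->] := blocks_lower g.
by rewrite oppr0; split=> [[]|].
Qed.

Let lieE (a b : {linear V -> V}) v : [lie a, b] v = a (b v) - b (a v).
Proof. by []. Qed.

Lemma lie_diag_diag a d a' d' :
  [lie diag_op a d, diag_op a' d'] = diag_op [lie a, a'] [lie d, d'].
Proof.
apply: linP => x; rewrite lieE !diagE !lieE !(linearD, linearB) /= !shiftK !linear0.
by rewrite !addr0 !add0r !linearN addrACA.
Qed.

Lemma lie_diag_upper a d b :
  [lie diag_op a d, upper_op b] = upper_op (a ** b - b ** d).
Proof.
apply: linP => x; rewrite lieE !diagE -[RHS]/(ein (a (b (oout x)) - b (d (oout x)))).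
by rewrite /= !linearB !linearD /= !shiftK !linear0 addr0 add0r.
Qed.

Lemma lie_diag_lower a d g :
  [lie diag_op a d, lower_op g] = lower_op (d ** g - g ** a).
Proof.
apply: linP => x; rewrite lieE !diagE -[RHS]/(oin (d (g (eout x)) - g (a (eout x)))).
by rewrite /= !linearB !linearD /= !shiftK !linear0 addr0 add0r.
Qed.

Lemma lie_upper_lower b g :
  [lie upper_op b, lower_op g] = diag_op (b ** g) (- (g ** b)).
Proof. by apply: linP => x; rewrite lieE diagE linNE linearN /= !shiftK. Qed.

Lemma transposes_lie a a' d d' : transposes a a' -> transposes d d' ->
  transposes [lie a, d] [lie d', a'].
Proof.
move=> aa' dd' i j; rewrite !lieE !linearB /=.
have := transposes_comp ec aa' dd' i j; have := transposes_comp ec dd' aa' i j.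
by move=> /= -> ->.
Qed.

(** For an antisymmetric form the identity will do.  For a symmetric form,
    exchange the vectors e_2n and e_(2n+1) up to sign. *)
Lemma sgn_skew_invertible : exists J J' : {linear V -> V}, [/\ sgn_skew J,
  forall x, J (J' x) = x & forall x, J' (J x) = x].
Proof.
have tr_id := transposes_id ec.
have tr_e := transposes_even ec; have tr_o := transposes_odd ec.
rewrite /sgn_skew; have [->|->] : sgn = 1 \/ sgn = -1 by case: (eps); [right|left].
  pose J : {linear V -> V} := - 1 *: (ein ** oout) + oin ** eout.
  have JJ x : J (J x) = - x.
    rewrite !linDE !linZE /= !scaleN1r !(linearD, linearN) /= !shiftK !linear0.
    by rewrite sub0r addr0 -opprD even_odd_split.
  exists J, (- J); split=> [|x|x]; last by rewrite linNE JJ opprK.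
    have -> : -1 *: J = - 1 *: (oin ** eout) + ein ** oout.
      by rewrite scalerDr scalerA mulrNN mulr1 scale1r addrC.
    apply: transposes_lin.
      exact: (transposes_comp ec tr_e (transposes_sym tr_o)).
    exact: (transposes_comp ec tr_o (transposes_sym tr_e)).
  by rewrite linNE linearN JJ opprK.
exists idfun, idfun; split=> //; rewrite opprK scale1r.
exact: tr_id.
Qed.

Section SkewIdeals.
Variable U : set {linear V -> V}.
Hypotheses (US : U `<=` skewM_set B) (subU : is_subspace U).
Hypothesis brU : forall X Y, skewM_set B X -> U Y -> U [lie X, Y].

Let UD X Y : U X -> U Y -> U (X + Y).
Proof. by have [_ +] := subU => /(_ 1 X Y); rewrite scale1r. Qed.
Let UZ t X : U X -> U (t *: X).
Proof. by have [U0 /(_ t X 0)] := subU; rewrite addr0 => H /H; apply. Qed.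
Let UN X : U X -> U (- X). Proof. by rewrite -scaleN1r; exact: UZ. Qed.
Let UB X Y : U X -> U Y -> U (X - Y). Proof. by move=> UX /UN; exact: UD. Qed.

Let half2 (X : {linear V -> V}) : 2%:R^-1 *: (X + X) = X.
Proof. by rewrite -mulr2n -scaler_nat scalerA mulVf // scale1r. Qed.

Let diagP a a' : transposes a a' -> skewM_set B (diag_op a (- a')).
Proof. exact: skewM_diag. Qed.

Local Notation idl := (idfun : {linear V -> V}).
Let D : {linear V -> V} := diag_op idl (- idl).

Let skewD : skewM_set B D. Proof. exact/diagP/transposes_id. Qed.

Let lieD_diag a d : [lie D, diag_op a d] = 0.
Proof.
by rewrite lie_diag_diag; apply: linP => x; rewrite diagE !lieE !linNE !linearN /=
  !subrr !linear0 addr0.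
Qed.

Let lieD_upper b : [lie D, upper_op b] = upper_op b + upper_op b.
Proof.
by rewrite lie_diag_upper; apply: linP => x;
  rewrite linDE -[LHS]/(ein (b (oout x) - b (- oout x))) linearN opprK linearD.
Qed.

Let lieD_lower g : [lie D, lower_op g] = - (lower_op g + lower_op g).
Proof.
by rewrite lie_diag_lower; apply: linP => x;
  rewrite linNE linDE -[LHS]/(oin (- g (eout x) - g (eout x))) linearB linearN opprD.
Qed.

(** The adjoint action of [D] multiplies the upper part by 2, the lower part by
    -2 and kills the diagonal part, so that the parts of [X] are combinations of
    [X] and its first two brackets with [D]. *)
Lemma ideal_blocks X : U X ->
  [/\ U (diag_op (eout ** X ** ein) (oout ** X ** oin)),
      U (upper_op (eout ** X ** oin)) & U (lower_op (oout ** X ** ein))].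
Proof.
move=> UX; have XE := block_decomposition X.
set d := diag_op _ _ in XE *; set u := upper_op _ in XE *; set l := lower_op _ in XE *.
have Dd : [lie D, d] = 0 by exact: lieD_diag.
have Du : [lie D, u] = u + u by exact: lieD_upper.
have Dl : [lie D, l] = - (l + l) by exact: lieD_lower.
clearbody d u l.
have U1 : U ((u + u) - (l + l)).
  have -> : (u + u) - (l + l) = [lie D, X].
    by rewrite XE !bracketDr Dd Du Dl add0r.
  exact: brU.
have U2 : U ((u + u) + (l + l)).
  rewrite -[X in U X]half2.
  have -> : u + u + (l + l) + (u + u + (l + l)) = [lie D, (u + u) - (l + l)].
    rewrite bracketBr !bracketDr Du Dl opprD !opprK.
    by rewrite addrACA.
  exact/UZ/brU.
have Uu : U u.
  rewrite -[u]half2 -[u + u]half2; apply: (UZ); apply: (UZ).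
  by have := UD U1 U2; rewrite addrACA addNr addr0.
have Ul : U l.
  rewrite -[l]half2 -[l + l]half2; apply: (UZ); apply: (UZ).
  by have := UB U2 U1; rewrite opprD opprK addrACA subrr add0r.
split=> //; have -> : d = X - u - l by rewrite XE addrAC addrK addrK.
by apply: (UB) => //; exact: UB.
Qed.

Definition diag_part : set {linear V -> V} :=
  [set a | exists2 a', transposes a a' & U (diag_op a (- a'))].

Let diag_op_lin t a d a' d' :
  diag_op (t *: a + a') (t *: d + d') = t *: diag_op a d + diag_op a' d'.
Proof.
apply: linP => x; rewrite -[RHS]/(t *: diag_op a d x + diag_op a' d' x) !diagE.
by rewrite !linDE !linZE !linearP /= scalerDr addrACA.
Qed.

(** The diagonal parts in U form a Lie ideal of the transposable operators, so
    they are all of them.  In particular [D] lies in U, and bracketing with [D]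
    reproduces all off-diagonal operators up to the factors 2 and -2. *)
Lemma diag_part_full a : diag_part a -> ~ finite_rank_plus_scalar a ->
  U = skewM_set B.
Proof.
move=> Pa nfa.
have diag_full : diag_part = transposable.
  apply: (@lie_ideal_full _ _ _ _ ec two_neq0 transposable diag_part _ _ _ _ a) => //.
  - exact: operator_algebra_transposable.
  - by move=> b [b' bb' _]; exists b'.
  - split=> [|t b g [b' bb' Ub] [g' gg' Ug]].
      exists 0; first exact: transposes0.
      suff -> : diag_op 0 (- 0) = 0 by exact: subU.1.
      by apply: linP => x; rewrite oppr0 diagE !lin0E !linear0 addr0.
    exists (t *: b' + g'); first exact: transposes_lin.
    by rewrite opprD -scalerN diag_op_lin; apply: UD => //; exact: UZ.
  - move=> b g [b' bb'] [g' gg' Ug].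
    exists [lie g', b']; first exact: transposes_lie.
    have := brU (diagP bb') Ug; rewrite lie_diag_diag bracketNl bracketNr opprK.
    by rewrite [[lie g', b']]bracketC opprK.
have UD1 : U D.
  have : diag_part idfun by rewrite diag_full; exact: transposable_id.
  move=> [a' ia' Ua']; suff a'E : a' = idl by move: Ua'; rewrite a'E.
  apply: (linear_coord_inj ec) => j; apply: (coord_inj ec) => i.
  by rewrite -ia' (transposes_id ec).
apply/seteqP; split=> // X SX; rewrite (block_decomposition X).
have /skewM_blocks[tra trb trg] := SX.
have lieD' Y : skewM_set B Y -> U [lie D, Y].
  by move=> SY; rewrite bracketC; apply/UN/brU.
apply: (UD); first apply: (UD).
- have [a'' t'' Ua''] : diag_part (eout ** X ** ein).
    by rewrite diag_full; eexists; exact: tra.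
  suff dE : oout ** X ** oin = - a'' by rewrite dE.
  apply: (linear_coord_inj ec) => j; apply: (coord_inj ec) => i.
  by rewrite linNE linearN /= -t'' tra linNE linearN /= opprK.
- rewrite -[upper_op _]half2 -lieD_upper; apply/UZ/lieD'.
  exact/skewM_upper.
- rewrite -[lower_op _]half2 -[X in _ *: X]opprK -lieD_lower scalerN; apply/UN/UZ/lieD'.
  exact/skewM_lower.
Qed.

Let brU' X Y : U X -> skewM_set B Y -> U [lie X, Y].
Proof. by move=> UX SY; rewrite bracketC; apply/UN/brU. Qed.

(** The bracket of [upper_op b] with a lower operator [g] is diagonal with block
    b g.  Choosing [g] supported on one half of the space, on which [b] still has
    infinite rank, prevents b g from being a nonzero scalar modulo finite rank:
    it vanishes on the other half. *)
Lemma upper_full b : U (upper_op b) -> ~ finite_rank b -> U = skewM_set B.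
Proof.
move=> Ub nfb; have sb : sgn_skew b by apply/skewM_upper/US.
have [J [J' [sJ JK J'K]]] := sgn_skew_invertible.
(* The half, even or odd, on which [b] has infinite rank is the image of [s];
   the other one is the image of [s']. *)
have [s [t [s' [t' [[st ts] [t's' ts'] nfbs]]]]] : exists s t s' t' : {linear V -> V},
    [/\ transposes s t /\ (forall x, t (s x) = x),
        (forall x, t' (s' x) = x) /\ (forall x, t (s' x) = 0) &
        ~ finite_rank (b ** s)].
  have [f1|n1] := pselect (finite_rank (b ** ein)); last first.
    exists ein, eout, oin, oout.
    by split=> //; split;
      try exact: transposes_even; move=> x; rewrite shiftK.
  have [f2|n2] := pselect (finite_rank (b ** oin)); last first.
    exists oin, oout, ein, eout.
    by split=> //; split;
      try exact: transposes_odd; move=> x; rewrite shiftK.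
  exfalso; apply: nfb.
  have -> : b = b ** ein ** eout + b ** oin ** oout.
    by apply: linP => x; rewrite linDE /= -linearD even_odd_split.
  by apply: finite_rankD; exact: finite_rank_compr.
pose g : {linear V -> V} := s ** J ** t.
have sg : sgn_skew g.
  have := transposes_comp ec (transposes_comp ec st sJ) (transposes_sym st).
  rewrite /sgn_skew /g; congr transposes.
  by apply: linP => x; rewrite -[LHS]/(s (- sgn *: J (t x))) linearZ.
apply: (@diag_part_full (b ** g)).
  exists (g ** b).
    have := transposes_comp ec sb sg.
    rewrite (_ : (- sgn *: g) ** (- sgn *: b) = g ** b) //.
    apply: linP => x; rewrite -[LHS]/(- sgn *: g (- sgn *: b x)) linearZ.
    by rewrite scalerA mulrNN sgnK scale1r.
  by rewrite -lie_upper_lower; apply: (brU' Ub); apply/skewM_lower.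
move=> [a fa].
(* Restricted to the other half, b g vanishes and only the scalar is left. *)
have a0 : a = 0.
  apply/eqP; rewrite -oppr_eq0; apply/eqP; apply: (finite_rank_scalar ec).
  rewrite (_ : _ *: _ = t' ** ((b ** g - a *: idl) ** s')).
    by apply: finite_rank_compl; exact: finite_rank_compr.
  apply: linP => x; rewrite -[RHS]/(t' ((b ** g - a *: idl) (s' x))).
  by rewrite linDE linNE !linZE /= ts' !linear0 add0r linearN linearZ /= t's' scaleNr.
apply: nfbs; rewrite (_ : b ** s = (b ** g - a *: idl) ** (s ** J')).
  exact: finite_rank_compr.
by apply: linP => x; rewrite a0 scale0r subr0 /= ts JK.
Qed.

(** Coordinates that do not occur in the range of [a] are ignored by [a']. *)
Lemma finite_rank_transposes a a' : transposes a a' -> finite_rank a -> finite_rank a'.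
Proof.
move=> aa' /(finite_rankE ec)[N aN].
apply: (@finite_rank_in _ _ _ N (fun i => a' (e i)) (fun x i => c i x)) => x.
have [M /(_ _ (leq_maxl _ N))[xE _]] := coord_bound ec x.
rewrite {1}xE -(subnKC (leq_maxr M N)) big_split_ord linearD !linear_sum /=.
rewrite [X in _ + X]big1 ?addr0 => [|i _].
  by apply: eq_bigr => i _; rewrite linearZ.
rewrite linearZ /= [a' _](_ : _ = 0) ?scaler0 //; apply: (coord_inj ec) => j.
by rewrite -aa' aN ?leq_addr // linear0.
Qed.

(** One of the three parts of [X] has infinite rank.  A lower part g gives the
    upper part 2 J g J by two brackets with an invertible [J].  A diagonal part
    f + t with f of finite rank and t nonzero gives the upper part 2 t J modulo
    finite rank by one bracket.  The other cases are [upper_full] and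
    [diag_part_full]. *)
Theorem skew_ideal_full X : U X -> ~ finite_rank X -> U = skewM_set B.
Proof.
move=> UX nfX; have [Ud Uu Ul] := ideal_blocks UX.
have [J [J' [sJ JK J'K]]] := sgn_skew_invertible.
have SJ : skewM_set B (upper_op J) by exact/skewM_upper.
have nfJ t : t != 0 -> ~ finite_rank (t *: J).
  move=> t0 /(finite_rank_compr J').
  rewrite (_ : (t *: J) ** J' = t *: idl) => [/(finite_rank_scalar ec)/eqP|].
    by rewrite (negbTE t0).
  by apply: linP => x; rewrite -[LHS]/(t *: J (J' x)) JK.
have [fu|] := pselect (finite_rank (eout ** X ** oin)); last exact: upper_full.
have [fl|nfl] := pselect (finite_rank (oout ** X ** ein)); last first.
  set g := oout ** X ** ein in Ul nfl *.
  have UJgJ : U (upper_op (J ** g ** J + J ** g ** J)).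
    have := brU' (brU SJ Ul) SJ; rewrite lie_upper_lower lie_diag_upper.
    congr (U (upper_op _)); apply: linP => x; rewrite linDE linNE linDE /=.
    by rewrite linearN opprK.
  apply: (upper_full UJgJ) => f2; apply: nfl.
  have -> : g = J' ** (2%:R^-1 *: (J ** g ** J + J ** g ** J)) ** J'.
    by rewrite half2; apply: linP => x; rewrite /= J'K JK.
  by apply: finite_rank_compr; apply: finite_rank_compl; exact: finite_rankZ.
have [da _ _] := (skewM_blocks X).1 (US UX).
set a := eout ** X ** ein in Ud da *; set a' := - (oout ** X ** oin) in da *.
rewrite -[oout ** X ** oin]opprK -/a' in Ud.
have [[t fat]|] := pselect (finite_rank_plus_scalar a); last first.
  by apply: diag_part_full; exists a'.
have t0 : t != 0.
  apply/eqP => t0; rewrite t0 scale0r subr0 in fat; apply: nfX.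
  have fa' := finite_rank_transposes da fat.
  have fsand (b f h : {linear V -> V}) : finite_rank f -> finite_rank (b ** f ** h).
    by move=> ff; apply: finite_rank_compr; exact: finite_rank_compl.
  rewrite (block_decomposition X) -/a -[oout ** X ** oin]opprK -/a'.
  apply: finite_rankD; last exact: fsand.
  apply: finite_rankD; last exact: fsand.
  apply: finite_rankD; apply: fsand => //.
  by rewrite -scaleN1r; exact: finite_rankZ.
clearbody a a'.
have fa't : finite_rank (a' - t *: idl).
  apply: finite_rank_transposes fat.
  rewrite -!scaleNr [a + _]addrC [a' + _]addrC.
  exact: transposes_lin (transposes_id ec) da.
have := brU' Ud SJ; rewrite lie_diag_upper => /upper_full; apply.
move=> faJ; apply: (nfJ (t *+ 2)); first by rewrite -mulr_natr mulf_neq0.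
have -> : (t *+ 2) *: J =
    (a ** J - J ** (- a')) - ((a - t *: idl) ** J + J ** (a' - t *: idl)).
  have cancel (u v w : V) : w + w = u + v - ((u - w) + (v - w)).
    by rewrite opprD !opprB addrACA ![_ + (w - _)]addrC !subrK.
  apply: linP => x; rewrite linZE mulr2n scalerDl (cancel (a (J x)) (J (a' x))).
  rewrite -[RHS]/(a (J x) - J (- a' x) - ((a (J x) - t *: J x) + J (a' x - t *: x))).
  by rewrite [J (- _)]linearN opprK [J (_ - _)]linearB [J (_ *: _)]linearZ.
apply: finite_rankD => //; rewrite -scaleN1r; apply: finite_rankZ.
by apply: finite_rankD; [exact: finite_rank_compr|exact: finite_rank_compl].
Qed.

End SkewIdeals.

End Skew.

(** * The ideals of the Mackey algebras *)

Section FiniteRankPlusScalars.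
Variables (K : fieldType) (V : lmodType K).
Implicit Types f g : {linear V -> V}.

Lemma finite_rank_plus_scalar_subspace :
  is_subspace (@finite_rank_plus_scalar K V).
Proof.
split=> [|t f g [a fa] [b gb]].
  by exists 0; rewrite scale0r subr0; exact: finite_rank0.
exists (t * a + b); rewrite scalerDl -scalerA opprD addrACA -scalerBr.
exact: finite_rankP.
Qed.

Lemma finite_rank_plus_scalar_lie f g :
  finite_rank_plus_scalar g -> finite_rank_plus_scalar [lie f, g].
Proof.
move=> [a ga]; exists 0; rewrite scale0r subr0.
have -> : [lie f, g] = [lie f, g - a *: (idfun : {linear V -> V})].
  apply: linP => x.
  rewrite -[LHS]/(f (g x) - g (f x)) -[RHS]/(f (g x - a *: x) - (g (f x) - a *: f x)).
  by rewrite linearB linearZ opprB addrA subrK.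
exact: finite_rank_bracket.
Qed.

Definition finite_rank_plus_scalar_ideal : lieIdeal {linear V -> V} :=
  LieIdeal finite_rank_plus_scalar_subspace finite_rank_plus_scalar_lie.

Variable S : lieSubalgebra {linear V -> V}.

Let sub_set : set (sub_lie S) := [set f | finite_rank_plus_scalar (val f)].

Let sub_set_subspace : is_subspace sub_set.
Proof.
have [fps0 fpsP] := finite_rank_plus_scalar_subspace.
split=> [|t f g Ff Fg]; rewrite /sub_set /mkset; first by rewrite val_lie0.
by rewrite val_lieP; exact: fpsP.
Qed.

Let sub_set_lie x y : sub_set y -> sub_set [lie x, y].
Proof.
move=> Fy; rewrite /sub_set /mkset val_bracket.
exact: finite_rank_plus_scalar_lie.
Qed.

Definition sub_finite_rank_plus_scalar_ideal : lieIdeal (sub_lie S) :=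
  LieIdeal sub_set_subspace sub_set_lie.

Lemma val_sub_ideal (f : {linear V -> V}) :
  (val @` sub_finite_rank_plus_scalar_ideal) f <->
  subalgebra_set S f /\ finite_rank_plus_scalar f.
Proof.
split=> [[g Fg <-]|[Sf Ff]]; first by split=> //; exact/set_mem/(valP g).
exists (Sub f (mem_set Sf)); last exact: SubK.
by rewrite /= /sub_set /mkset SubK.
Qed.

End FiniteRankPlusScalars.

Section MackeyAlgebras.
Variables (K : fieldType) (V W : lmodType K) (p : {bilinear V -> W -> K^o}).

Lemma gl_glM f : gl p f -> glM_set p f.
Proof.
move=> [n [a [k [ga ->]]]]; have [M0 MP] := glM_subspace p.
apply: (big_ind (glM_set p)) => [//|f1 f2 M1 M2|i _].
  by rewrite -[f1]scale1r; exact: MP.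
rewrite -[_ *: _]addr0; apply: MP => //.
have [v _ [w _ <-]] := ga i; apply/glMP => w'; exists (p v w' *: w) => x.
rewrite -[LHS]/(p (p x w *: v) w') linearZl_LR linearZr_LR.
exact: mulrC.
Qed.

Lemma gl_finite_rank f : gl p f -> finite_rank f.
Proof.
move=> [n [a [k [ga ->]]]].
apply: (big_ind (fun f => finite_rank f)) => [|f1 f2|i _].
- exact: finite_rank0.
- exact: finite_rankD.
apply: finite_rankZ; have [v _ [w _ <-]] := ga i.
by apply: (@finite_rank_in _ _ _ 1 (fun=> v) (fun x _ => p x w)) => x; rewrite big_ord1.
Qed.

Variables (v : nat -> V) (w : nat -> W).
Hypothesis vw : coord_system v (fun i => dual_of p (w i)).

(** The first N coordinates of [f x], which determine it, are given by elements
    of W because [f] has an adjoint on W. *)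
Lemma finite_rank_gl f : glM_set p f -> finite_rank f -> gl p f.
Proof.
move=> /glMP fW /(finite_rankE vw)[N fN].
have /choice[w' w'P] i := fW (w i).
exists N, (fun i => tensor_op p (v i) (w' i) : {linear V -> V}), (fun=> 1).
split=> [i|]; first by exists (v i) => //; exists (w' i).
apply: linP => x; apply: (coord_inj vw) => j.
have -> : (\sum_(i < N) 1 *: (tensor_op p (v i) (w' i) : {linear V -> V})) x =
    \sum_(i < N) p x (w' i) *: v i.
  elim/big_ind2: _ => [//|a b a' b' <- <- //|i _].
  by rewrite scale1r.
rewrite (coord_sum vw _ (fun i => p x (w' i))).
case: ltnP => [_|/fN ->] //; exact: w'P.
Qed.

Lemma direct_sum_gl_scalars S :
    (forall f, S f <-> glM_set p f /\ finite_rank_plus_scalar f) ->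
  direct_sum (gl p) (scalar_ops V) S.
Proof.
move=> SE; have [M0 MP] := glM_subspace p.
have Mid a : glM_set p (a *: (idfun : {linear V -> V})).
  by apply/glMP => y; exists (a *: y) => x; rewrite linZE linearZl_LR linearZr_LR.
split; apply/seteqP; split=> f.
- move=> /SE[Mf [a fa]]; exists (f - a *: (idfun : {linear V -> V})).
    apply: finite_rank_gl fa; rewrite addrC -scaleNr -[f]scale1r.
    by rewrite addrC; apply: MP => //; exact: Mid.
  by exists (a *: (idfun : {linear V -> V})); [exists a|rewrite subrK].
- move=> [g gg [_ [a _ <-] <-]]; apply/SE; split.
    by rewrite -[g]scale1r; apply: MP; [exact: gl_glM|exact: Mid].
  by exists a; rewrite addrK; exact: gl_finite_rank.
- move=> [/gl_finite_rank + [a _ fE]]; rewrite -fE => /(finite_rank_scalar vw) ->.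
  by rewrite scale0r.
- move=> ->; split.
    exists 0%N, (fun i => 0), (fun=> 0); split=> [[]//|].
    by rewrite big_ord0.
  by exists 0 => //; rewrite scale0r.
Qed.

(** An operator preserves W if and only if each coordinate of [f x] is given by
    an element of W, that is, by a row with finitely many nonzero entries. *)
Lemma glM_transposable :
    (forall y, exists N, y = \sum_(i < N) p (v i) y *: w i) ->
  glM_set p = transposable v (fun i => dual_of p (w i)).
Proof.
move=> wE; have pvw i k : p (v k) (w i) = (i == k)%:R := coordE vw i k.
have pv_sum n (d : nat -> K) i :
    p (v i) (\sum_(k < n) d k *: w k) = if (i < n)%N then d i else 0.
  rewrite linear_sumr; under eq_bigr => k _ do rewrite linearZr_LR pvw.
  case: ltnP => [lt_in|le_ni].
    rewrite (bigD1 (Ordinal lt_in)) //= eqxx [_ *: _]mulr1 big1 ?addr0 // => k.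
    by rewrite -val_eqE /= => /negbTE->; rewrite scaler0.
  rewrite big1 // => k _; rewrite ltn_eqF ?scaler0 //.
  exact: leq_trans (ltn_ord k) le_ni.
apply/seteqP; split=> f.
  move=> /glMP fW; have /choice[w' w'P] j := fW (w j).
  have /choice[N NP] j := wE (w' j).
  exists (linear_ext vw (fun j => \sum_(i < N j) p (v i) (w' j) *: v i)) => i j.
  rewrite linear_extE (coord_sum vw _ (fun i => p (v i) (w' j))).
  by rewrite -[LHS]/(p (f (v i)) (w j)) w'P {1}NP (pv_sum _ (fun k => p (v k) (w' j))).
move=> [f' ff']; apply/glMP => y.
have /choice[N NP] k := coord_support vw (f' (v k)).
pose w' k := \sum_(i < N k) p (f' (v k)) (w i) *: w i.
have w'P k x : p (f x) (w k) = p x (w' k).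
  apply: (congr1 (fun g : {linear V -> K^o} => g x) (@linear_coord_inj _ _ _ _ vw _
    (dual_of p (w k) \o f : {linear V -> K^o}) (dual_of p (w' k)) _)) => i.
  rewrite -[LHS]/(dual_of p (w k) (f (v i))) ff' -[RHS]/(p (v i) (w' k)).
  by rewrite (pv_sum _ (fun i => p (f' (v k)) (w i))); case: ltnP => [//|/NP].
have [M yE] := wE y; exists (\sum_(k < M) p (v k) y *: w' k) => x.
rewrite {1}yE !linear_sumr; apply: eq_bigr => k _.
by rewrite !linearZr_LR w'P.
Qed.

End MackeyAlgebras.

Section Noncommuting.
Variables (K : fieldType) (V : lmodType K).
Variables (e : nat -> V) (c : nat -> {linear V -> K^o}).
Hypothesis ec : coord_system e c.

(** The bracket of an idempotent of infinite rank and corank with an operator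
    from its kernel to its image is the latter, which has infinite rank and
    square zero. *)
Lemma transposable_bracket : exists x y : {linear V -> V},
  [/\ transposable e c x, transposable e c y &
      ~ finite_rank_plus_scalar [lie x, y]].
Proof.
pose x : {linear V -> V} := even_in ec \o even_out ec.
pose y : {linear V -> V} := even_in ec \o odd_out ec.
have tre : transposable e c (even_in ec) by eexists; exact: transposes_even.
have tre' : transposable e c (even_out ec).
  by eexists; exact: transposes_sym (transposes_even ec).
have tro' : transposable e c (odd_out ec).
  by eexists; exact: transposes_sym (transposes_odd ec).
exists x, y; split; [exact: transposable_comp|exact: transposable_comp|].
have -> : [lie x, y] = y.
  apply: linP => z; rewrite -[LHS]/(x (y z) - y (x z)) /x /y /=.
  by rewrite even_inK odd_out_even_in linear0 subr0.
move=> [a ya]; have a0 : a = 0.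
  apply/eqP; rewrite -oppr_eq0; apply/eqP; apply: (finite_rank_scalar ec).
  have := finite_rank_compl (odd_out ec) (finite_rank_compr (odd_in ec) ya).
  congr finite_rank; apply: linP => z.
  rewrite -[LHS]/(odd_out ec (y (odd_in ec z) - a *: odd_in ec z)) /y /=.
  by rewrite linearB linearZ /= !odd_inK odd_out_even_in sub0r -scaleNr.
suff /(finite_rank_scalar ec)/eqP : finite_rank (1 *: (idfun : {linear V -> V})).
  by rewrite oner_eq0.
have := finite_rank_compl (even_out ec) (finite_rank_compr (odd_in ec) ya).
congr finite_rank; apply: linP => z; rewrite a0 scale0r subr0 scale1r /=.
by rewrite odd_inK even_inK.
Qed.

End Noncommuting.

(** * The three quotients *)

Lemma skew_simple (K : fieldType) (V : lmodType K) (eps : bool)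
    (B : {hermitian V for eps & idfun}) :
    (2%:R : K) != 0 -> (forall t : K, exists s, s ^+ 2 = t) ->
    countable_dim V -> nondegenerate_form B ->
  simple_lie (lie_quot (skew_fin B)).
Proof.
move=> two0 sqrtK hV nd; have [e [c hB]] := hyperbolic_basis two0 hV nd sqrtK.
have imE (f : {linear V -> V}) : (val @` skew_fin B) f -> finite_rank f.
  by move=> [g gF <-].
apply: simple_sub_lie_quot => [|U US subU brU [u Uu nu]].
  have [J [J' [sJ JK _]]] := sgn_skew_invertible hB.
  pose D := diag_op hB idfun (- (idfun : {linear V -> V})).
  exists D, (upper_op hB J); split; [|exact/skewM_upper|move=> /imE].
    exact/skewM_diag/transposes_id/hB.1.
  rewrite lie_diag_upper => fr.
  have fr2 : finite_rank (2%:R *: (idfun : {linear V -> V})).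
    have := finite_rank_compl (even_out hB.1) (finite_rank_compr
      (odd_in hB.1 \o J' : {linear V -> V}) fr).
    congr finite_rank; apply: linP => x.
    rewrite -[LHS]/(even_out hB.1 (even_in hB.1 (J (odd_out hB.1 (odd_in hB.1 (J' x)))
      - J (- odd_out hB.1 (odd_in hB.1 (J' x)))))).
    by rewrite odd_inK even_inK linearN opprK JK linZE scaler_nat.
  by have /eqP := finite_rank_scalar hB.1 fr2; rewrite (negbTE two0).
apply: (skew_ideal_full two0 hB US subU brU Uu).
move=> fu; apply: nu; exists (Sub u (mem_set (US _ Uu))); last exact: SubK.
by rewrite /= /skew_fin_set /mkset SubK.
Qed.

Theorem theorem6p3 (R : realType) (V : lmodType R[i]) (hV : countable_dim V) :
  [/\ (* a *)
      forall (W : lmodType R[i]) (p : {bilinear V -> W -> R[i]^o}),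
        countable_dim W -> nondegenerate_form p ->
        exists I : lieIdeal (sub_lie (glM p)),
          direct_sum (gl p) (scalar_ops V) (val @` I) /\
          simple_lie (lie_quot I),
      (* b *)
      exists I : lieIdeal {linear V -> V},
        direct_sum (gl (eval_pairing (V := V))) (scalar_ops V) I /\
        simple_lie (lie_quot I)
    & (* c *)
      (forall B : {symmetric V},
         nondegenerate_form B -> simple_lie (lie_quot (skew_fin B))) /\
      (forall B : {skew_symmetric V},
         nondegenerate_form B -> simple_lie (lie_quot (skew_fin B)))].
Proof.
have two0 : (2%:R : R[i]) != 0 by rewrite Num.Theory.pnatr_eq0.
have sqrtK (t : R[i]) : exists s, s ^+ 2 = t.
  by eexists; exact: Num.Theory.sqrtCK.
split; last by split=> B nd; exact: skew_simple.
- move=> W p hW nd; have [v [w [vw wE]]] := biorthogonal_bases hV hW nd.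
  exists (sub_finite_rank_plus_scalar_ideal (glM p)); split.
    by apply: (direct_sum_gl_scalars vw) => f; exact: val_sub_ideal.
  have glME := glM_transposable vw wE.
  apply: simple_sub_lie_quot => [|U UM subU brU [u Uu nu]].
    have [x [y [tx ty nxy]]] := transposable_bracket vw.
    by exists x, y; split; [rewrite /= glME|rewrite /= glME|move=> /val_sub_ideal[]].
  have opA := operator_algebra_transposable vw; rewrite -glME in opA.
  apply: (lie_ideal_full two0 opA UM subU brU Uu) => fu.
  by apply: nu; apply/val_sub_ideal; split=> //; exact: UM.
- have [e he] := hV; have [c ec] := coord_system_of_basis he.
  exists (finite_rank_plus_scalar_ideal V); split.
    apply: (@direct_sum_gl_scalars _ _ _ _ e c) => [|f].
      have -> // : (fun i => dual_of (eval_pairing (V:=V)) (c i)) = c.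
      by apply/funext => i; apply: linP.
    split=> [fF|[]//]; split=> //; apply/glMP => w.
    by exists (w \o f : {linear V -> R[i]^o}).
  apply: simple_lie_quot => [|J subJ Jbr [u Ju nu]].
    have [x [y [_ _ nxy]]] := transposable_bracket ec; by exists x, y.
  apply: (lie_ideal_full two0 (operator_algebra_setT ec) _ subJ _ Ju nu) => //.
  by move=> a b _; exact: Jbr.
Qed.
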